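(* Let $\mu$ be a probability measure on $\mathbb{R}$ with zero mean and unit variance, and for $n\ge1$ let $\mu_n$ be the probability measure $$\mu_n(dx)=\underbrace{\mu\boxplus\cdots\boxplus\mu}_{n\text{ times}}(\sqrt{n}\,dx).$$ Let $\varepsilon>0$ and $I_\varepsilon=[-2+\varepsilon,2-\varepsilon]$. Then for all sufficiently large $n$, $\mu_n$ is (Lebesgue) absolutely continuous everywhere on $I_\varepsilon$, and the density $d\mu_n/dx$ converges uniformly on $I_\varepsilon$, as $n\to\infty$, to the density $\frac{1}{2\pi}\sqrt{(4-x^2)_+}$ of the standard semicircle law.
   Context: Here $\boxplus$ denotes free additive convolution of probability measures on $\mathbb{R}$. Equivalently, $\mu_n$ is the spectral distribution of $S_n=(X_1+\cdots+X_n)/\sqrt{n}$, where $X_1,\dots,X_n$ are free self-adjoint random variables each with spectral distribution $\mu$; i.e. $\mu_n(S)=\mu^{\boxplus n}(\sqrt{n}S)$ for Borel $S\subset\mathbb{R}$. Free convolution: with $m_\mu(z):=\int_{\mathbb{R}}\frac{\mu(dx)}{x-z}$ for $z\in\mathbb{C}^+:=\{\Im z>0\}$, $\mu_1\boxplus\mu_2$ is the probability measure whose Stieltjes transform satisfies $m_{\mu_1\boxplus\mu_2}(z)=m_{\mu_1}(\omega_1(z))=m_{\mu_2}(\omega_2(z))$ and $z-1/m_{\mu_1\boxplus\mu_2}(z)=\omega_1(z)+\omega_2(z)$ on $\mathbb{C}^+$, where $\omega_1,\omega_2:\mathbb{C}^+\to\mathbb{C}^+$ are analytic with $\Im\omega_j(z)\ge\Im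 z$ and $\omega_j(z)=z+o(z)$ as $z\to\infty$ in each sector $\Im z>\kappa|\Re z|$, $\kappa>0$. The density of a free convolution at a point is understood as $\pi^{-1}\lim_{\eta\downarrow0}\Im m(x+i\eta)$, with $m$ its Stieltjes transform. *)

(* Defs.v *)
From HB Require Import structures.
From mathcomp Require Import all_boot all_order all_algebra.
From mathcomp Require Import complex.
From mathcomp Require Import all_classical all_reals all_analysis.
From mathcomp Require Import measurable_realfun.

Set Implicit Arguments.
Unset Strict Implicit.
Unset Printing Implicit Defensive.

Import Order.TTheory GRing.Theory Num.Theory.
Import numFieldNormedType.Exports.

Local Open Scope classical_set_scope.
Local Open Scope ring_scope.
Local Open Scope complex_scope.

Notation real_law R := (probability (measurableTypeR R) R).

Section free_convolution.
Context {R : realType}.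
Implicit Types (mu nu : real_law R) (z : R[i]) (omega : R[i] -> R[i]).

(* The integrand is bounded for Im z != 0, so both real integrals are proper
   there; for real z the value carries no meaning. *)
Definition stieltjes mu z : R[i] :=
  (\int[mu]_x complex.Re ((x%:C - z)^-1)) +i*
  (\int[mu]_x complex.Im ((x%:C - z)^-1)).

(* R[i]^o is R[i] as a normed space over itself, so derivability in the
   direction 1 is complex differentiability. *)
Definition analytic_on_upper omega : Prop :=
  forall z, 0 < complex.Im z ->
    derivable (omega : (R[i])^o -> (R[i])^o) z 1.

(* omega z = z + o(z) as z -> oo in each sector Im z > kappa |Re z| *)
Definition sectorially_id_at_infinity omega : Prop :=
  forall kappa : R, 0 < kappa -> forall e : R, 0 < e ->
  exists M : R, forall z, kappa * `|complex.Re z| < complex.Im z ->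
    M%:C <= `|z| -> `|omega z - z| <= e%:C * `|z|.

Definition subordination omega : Prop :=
  [/\ analytic_on_upper omega,
      forall z, 0 < complex.Im z -> complex.Im z <= complex.Im (omega z) &
      sectorially_id_at_infinity omega].

Definition is_free_convolution mu1 mu2 nu : Prop :=
  exists omega1 omega2 : R[i] -> R[i],
    [/\ subordination omega1, subordination omega2 &
        forall z, 0 < complex.Im z ->
          [/\ stieltjes nu z = stieltjes mu1 (omega1 z),
              stieltjes nu z = stieltjes mu2 (omega2 z) &
              z - (stieltjes nu z)^-1 = omega1 z + omega2 z]].

(* is_free_power mu n nu : nu is the free convolution of n copies of mu, for
   n >= 1 *)
Inductive is_free_power mu : nat -> real_law R -> Prop :=
| is_free_power1 : is_free_power mu 1 mu
| is_free_powerS n nu nu' : is_free_power mu n nu ->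
    is_free_convolution nu mu nu' -> is_free_power mu n.+1 nu'.

End free_convolution.

Section normalized_law.
Context {R : realType}.

Definition div_sqrt (n : nat) : measurableTypeR R -> measurableTypeR R :=
  fun x : R => x / Num.sqrt n%:R.

Lemma measurable_div_sqrt n : measurable_fun setT (div_sqrt n).
Proof. exact: (@mulrr_measurable R setT). Qed.

HB.instance Definition _ n :=
  isMeasurableFun.Build _ _ _ _ (div_sqrt n) (measurable_div_sqrt n).

(* The image of nu under x |-> x / sqrt n, that is S |-> nu (sqrt n * S). *)
Definition normalized (nu : real_law R) (n : nat) : real_law R :=
  distribution nu (div_sqrt n).

End normalized_law.

Section densities.
Context {R : realType}.

Definition boundary_im (nu : real_law R) (x eta : R) : R :=
  complex.Im (stieltjes nu (x +i* eta)).

(* Only meaningful where the limit exists. *)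
Definition density (nu : real_law R) (x : R) : R :=
  pi^-1 * lim (boundary_im nu x eta @[eta --> 0^'+]).

Definition semicircle_density (x : R) : R :=
  (2 * pi)^-1 * Num.sqrt (Num.max (4 - x ^+ 2) 0).

End densities.

(* Main.v *)
Require Import Defs.
From HB Require Import structures.
From mathcomp Require Import all_boot all_order all_algebra.
From mathcomp Require Import complex.
From mathcomp Require Import all_classical all_reals all_analysis.
From mathcomp Require Import ring lra.
From mathcomp Require Import measurable_realfun.

Import Order.TTheory GRing.Theory Num.Theory.
Import numFieldNormedType.Exports.
Set Implicit Arguments.
Unset Strict Implicit.
Unset Printing Implicit Defensive.
Local Open Scope classical_set_scope.
Local Open Scope ring_scope.

(** Write [m] for a Stieltjes transform and [F = -1/m].  Iterating the
    subordination relations shows that, for the [n]-th free power [nu] of [mu],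
    every [z] in the upper half-plane has [n] preimages [u_k] with
    [m_mu (u_k) = m_nu z], [Im u_k >= Im z] and
    [z + (n - 1) F_nu z = \sum_k u_k] ([free_power_preimages]).

    Since [mu] has mean zero and variance one, [F_mu u = u - 1/u + o(1/|u|)] as
    [u] grows inside a sector ([excess_asymp], [excess_asymp_lip]), and [m_mu]
    is injective far from the real axis.  So as long as all the [u_k] lie at
    height at least [c sqrt n], they coincide; with [z = sqrt n * zeta] and
    [u_k = sqrt n * v] the relation above becomes [v + 1/v = zeta + delta v],
    where [delta] is small and has a small Lipschitz constant ([bulk_point]).
    This is a perturbation of the equation [s + 1/s = zeta] whose solution [s]
    in the upper half-plane gives the semicircle law through [-1/s].

    The height assumption propagates.  When [Re zeta] stays away from [-2] and
    [2], a solution with [Im v >= c] has in fact [Im v >= 2 c]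
    ([joukowsky_gap]).  The lowest height among the preimages varies
    continuously along a vertical line, is at least [2 c] (in units of [sqrt n])
    at [Im zeta = 1] and takes no value between [c] and [2 c]; hence it stays at
    [2 c] or above down to the real axis ([preimages_large]).

    The map [s |-> s + 1/s] is bi-Lipschitz between points of bounded modulus
    and height at least [c] ([joukowsky_stable]).  It follows that the Stieltjes
    transform of the normalized law is Lipschitz on the strip
    [|Re zeta| <= 2 - e, 0 < Im zeta <= 1] and uniformly close to that of the
    semicircle law ([local_semicircle_law]).

    A law whose transform is Lipschitz on such a strip has boundary values on
    the real segment, has no atom there, and Stieltjes inversion identifies it
    with its density: integrate the Poisson kernel with Fubini's theorem, let
    the height tend to zero, and compare two finite measures on half-open
    intervals ([boundary_value_interval], [density_formula]). *)

(** * Complex moduli and expectations *)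

(** The modulus with values in [R] rather than in [R[i]], so that estimates take
    place in a totally ordered field. *)
Local Notation abs := Normc.normc.
Local Notation Re := complex.Re.
Local Notation Im := complex.Im.

Section modulus.
Context {R : realType}.
Implicit Types z w : R[i].
Local Open Scope complex_scope.

Lemma absE z : abs z = Num.sqrt (Re z ^+ 2 + Im z ^+ 2).
Proof. by case: z. Qed.

Lemma abs_ge0 z : 0 <= abs z.
Proof. by rewrite absE sqrtr_ge0. Qed.

Lemma absM z w : abs (z * w) = abs z * abs w.
Proof. exact: Normc.normcM. Qed.

Lemma absV z : abs z^-1 = (abs z)^-1.
Proof. exact: Normc.normcV. Qed.

Lemma absD z w : abs (z + w) <= abs z + abs w.
Proof. exact: le_normcD. Qed.

Lemma absN z : abs (- z) = abs z.
Proof. exact: normcN. Qed.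

Lemma absB z w : abs (z - w) <= abs z + abs w.
Proof. by rewrite -(absN w) absD. Qed.

Lemma abs_distC z w : abs (z - w) = abs (w - z).
Proof. by rewrite -absN opprB. Qed.

Lemma abs0 : abs (0 : R[i]) = 0.
Proof. exact: Normc.normc0. Qed.

Lemma abs_eq0 z : abs z = 0 -> z = 0.
Proof. exact: Normc.eq0_normc. Qed.

Lemma abs_real (x : R) : abs (x%:C) = `|x|.
Proof. by rewrite absE /= expr0n addr0 sqrtr_sqr. Qed.

Lemma Re_le_abs z : `|Re z| <= abs z.
Proof.
by rewrite absE -sqrtr_sqr ler_sqrt ?addr_ge0 ?sqr_ge0// lerDl sqr_ge0.
Qed.

Lemma Im_le_abs z : `|Im z| <= abs z.
Proof.
by rewrite absE -sqrtr_sqr ler_sqrt ?addr_ge0 ?sqr_ge0// lerDr sqr_ge0.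
Qed.

Lemma le_abs_of_Im (y : R) z : y <= Im z -> y <= abs z.
Proof.
by move=> yz; apply: le_trans yz (le_trans (ler_norm _) (Im_le_abs z)).
Qed.

Lemma abs_le_ReIm z : abs z <= `|Re z| + `|Im z|.
Proof.
rewrite absE -(ger0_norm (addr_ge0 (normr_ge0 (Re z)) (normr_ge0 (Im z)))).
rewrite -sqrtr_sqr ler_sqrt ?sqr_ge0// sqrrD !real_normK ?num_real//.
by rewrite -addrA lerD2l lerDr mulrn_wge0// mulr_ge0.
Qed.

Lemma ReD z w : Re (z + w) = Re z + Re w. Proof. by case: z w => ? ? []. Qed.
Lemma ImD z w : Im (z + w) = Im z + Im w. Proof. by case: z w => ? ? []. Qed.
Lemma ReN z : Re (- z) = - Re z. Proof. by case: z. Qed.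
Lemma ImN z : Im (- z) = - Im z. Proof. by case: z. Qed.
Lemma ReB z w : Re (z - w) = Re z - Re w. Proof. by rewrite ReD ReN. Qed.
Lemma ImB z w : Im (z - w) = Im z - Im w. Proof. by rewrite ImD ImN. Qed.
Lemma ReM z w : Re (z * w) = Re z * Re w - Im z * Im w.
Proof. by case: z w => ? ? []. Qed.
Lemma ImM z w : Im (z * w) = Re z * Im w + Im z * Re w.
Proof. by case: z w => ? ? []. Qed.
Lemma ReV z : Re z^-1 = Re z / (Re z ^+ 2 + Im z ^+ 2).
Proof. by case: z. Qed.
Lemma ImV z : Im z^-1 = - (Im z / (Re z ^+ 2 + Im z ^+ 2)).
Proof. by case: z. Qed.

Lemma complex_eq z w : Re z = Re w -> Im z = Im w -> z = w.
Proof. by case: z w => ? ? [? ?] /= -> ->. Qed.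

Lemma abs_div_le z w (a b : R) : abs z <= a -> 0 < b -> b <= abs w ->
  abs (z / w) <= a / b.
Proof.
move=> za b0 bw; rewrite absM absV; apply: ler_pM => //.
- exact: abs_ge0.
- by rewrite invr_ge0 abs_ge0.
- by rewrite lef_pV2 ?posrE// (lt_le_trans b0).
Qed.

Lemma Im_scale (w : R) z : Im (w%:C * z) = w * Im z.
Proof. by rewrite ImM /= mul0r addr0. Qed.

Lemma abs_scale (w : R) z : 0 < w -> abs (w%:C * z) = w * abs z.
Proof. by move=> w0; rewrite absM abs_real gtr0_norm. Qed.

Lemma realC_neq0 (w : R) : 0 < w -> w%:C != 0 :> R[i].
Proof. by move=> w0; apply/eqP => /complexI w00; rewrite w00 ltxx in w0. Qed.
End modulus.

Section complex_expectation.
Context {R : realType}.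
Context (mu : real_law R).
Implicit Types (f g : R -> R[i]) (h : R -> R).
Local Open Scope complex_scope.

Definition cexpect f : R[i] :=
  (\int[mu]_x Re (f x)) +i* (\int[mu]_x Im (f x)).

Definition cmeasurable f :=
  measurable_fun (setT : set (measurableTypeR R)) (fun x => Re (f x)) /\
  measurable_fun (setT : set (measurableTypeR R)) (fun x => Im (f x)).

Definition rintegrable h := mu.-integrable setT (EFin \o h).

Definition cintegrable f :=
  rintegrable (fun x => Re (f x)) /\ rintegrable (fun x => Im (f x)).

Lemma cmeasurable_real h : measurable_fun (setT : set (measurableTypeR R)) h ->
  cmeasurable (fun x => (h x)%:C).
Proof. by move=> mh; split => //=; exact: measurable_cst. Qed.

Lemma cmeasurableD f g : cmeasurable f -> cmeasurable g ->
  cmeasurable (fun x => f x + g x).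
Proof.
move=> [f1 f2] [g1 g2]; split.
- by under eq_fun do rewrite ReD; exact: measurable_funD.
- by under eq_fun do rewrite ImD; exact: measurable_funD.
Qed.

Lemma cmeasurableN f : cmeasurable f -> cmeasurable (fun x => - f x).
Proof.
move=> [f1 f2]; split.
- by under eq_fun do rewrite ReN; exact: measurableT_comp.
- by under eq_fun do rewrite ImN; exact: measurableT_comp.
Qed.

Lemma cmeasurableM f g : cmeasurable f -> cmeasurable g ->
  cmeasurable (fun x => f x * g x).
Proof.
move=> [f1 f2] [g1 g2]; split.
- under eq_fun do rewrite ReM.
  by apply: measurable_funB; exact: measurable_funM.
- under eq_fun do rewrite ImM.
  by apply: measurable_funD; exact: measurable_funM.
Qed.

Lemma cmeasurable_cst (c : R[i]) : cmeasurable (fun=> c).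
Proof. by split; exact: measurable_cst. Qed.

Lemma measurable_inv d (T : measurableType d) (k : T -> R) :
  (forall x, k x != 0) -> measurable_fun setT k ->
  measurable_fun setT (fun x => (k x)^-1).
Proof.
move=> k0 mk.
apply: (@measurable_comp _ _ _ _ _ _ [set r : R | r != 0] GRing.inv) => //.
- apply: open_measurable; rewrite (_ : mkset _ = ~` [set 0]).
    by apply: closed_openC; exact: closed_eq.
  by apply/seteqP; split => r /= => [/eqP|/eqP].
- by move=> r [x _ <-] /=.
- apply: open_continuous_measurable_fun.
    rewrite (_ : mkset _ = ~` [set 0]).
      by apply: closed_openC; exact: closed_eq.
    by apply/seteqP; split => r /= => [/eqP|/eqP].
  by apply/in_setP => x /= x0; exact: inv_continuous.
Qed.

Lemma cmeasurableV f : (forall x, f x != 0) -> cmeasurable f ->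
  cmeasurable (fun x => (f x)^-1).
Proof.
move=> f0 [f1 f2].
have n0 x : Re (f x) ^+ 2 + Im (f x) ^+ 2 != 0.
  apply: contra (f0 x); rewrite paddr_eq0 ?sqr_ge0// !sqrf_eq0.
  by move=> /andP[/eqP a /eqP b]; apply/eqP/complex_eq.
have m : measurable_fun (setT : set (measurableTypeR R))
    (fun x => (Re (f x) ^+ 2 + Im (f x) ^+ 2)^-1).
  by apply: measurable_inv => //; apply: measurable_funD;
    exact: measurable_funX.
split.
- under eq_fun do rewrite ReV.
  exact: measurable_funM.
- under eq_fun do rewrite ImV.
  by apply: measurableT_comp => //; exact: measurable_funM.
Qed.

Lemma rintegrable_dom h h' : measurable_fun (setT : set (measurableTypeR R)) h ->
  (forall x, `|h x| <= h' x) -> rintegrable h' -> rintegrable h.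
Proof.
move=> mh hh' ih'; apply: (le_integrable measurableT _ _ ih').
  exact/measurable_EFinP.
by move=> x _ /=; rewrite lee_fin (le_trans (hh' x))// ler_norm.
Qed.

Lemma cintegrable_dom f h : cmeasurable f -> (forall x, abs (f x) <= h x) ->
  rintegrable h -> cintegrable f.
Proof.
move=> [f1 f2] fh ih; split; apply: rintegrable_dom ih => // x.
- exact: le_trans (Re_le_abs _) (fh x).
- exact: le_trans (Im_le_abs _) (fh x).
Qed.

(** The factor 2 comes from estimating real and imaginary parts separately. *)
Lemma abs_cexpect_le f h : cmeasurable f -> (forall x, abs (f x) <= h x) ->
  rintegrable h -> abs (cexpect f) <= 2 * \int[mu]_x h x.
Proof.
move=> mf fh ih; have [i1 i2] := cintegrable_dom mf fh ih.
apply: le_trans (abs_le_ReIm _) _ => /=; rewrite mulr_natl mulr2n.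
have B k : rintegrable k -> (forall x, `|k x| <= h x) ->
    `|\int[mu]_x k x| <= \int[mu]_x h x.
  move=> ik kh; apply: le_trans (le_normr_Rintegral measurableT ik) _.
  apply: le_Rintegral => //; exact: integrable_norm.
apply: lerD; apply: B => // x.
- exact: le_trans (Re_le_abs _) (fh x).
- exact: le_trans (Im_le_abs _) (fh x).
Qed.

Lemma cexpectD f g : cintegrable f -> cintegrable g ->
  cexpect (fun x => f x + g x) = cexpect f + cexpect g.
Proof.
move=> [f1 f2] [g1 g2]; apply: complex_eq; rewrite ?ReD ?ImD /=.
- by under eq_Rintegral do rewrite ReD; rewrite RintegralD.
- by under eq_Rintegral do rewrite ImD; rewrite RintegralD.
Qed.

Lemma rintegrableZ (a : R) h : rintegrable h -> rintegrable (fun x => a * h x).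
Proof. by move=> ih; exact: (integrableZl measurableT a ih). Qed.

Lemma rintegrableD h k : rintegrable h -> rintegrable k ->
  rintegrable (fun x => h x + k x).
Proof. exact: integrableD. Qed.

Lemma rintegrableB h k : rintegrable h -> rintegrable k ->
  rintegrable (fun x => h x - k x).
Proof. exact: integrableB. Qed.

Lemma cexpectZ (c : R[i]) f : cintegrable f ->
  cexpect (fun x => c * f x) = c * cexpect f.
Proof.
move=> [f1 f2]; apply: complex_eq; rewrite ?ReM ?ImM /=.
- under eq_Rintegral do rewrite ReM.
  by rewrite RintegralB ?RintegralZl//; exact: rintegrableZ.
- under eq_Rintegral do rewrite ImM.
  by rewrite RintegralD ?RintegralZl//; exact: rintegrableZ.
Qed.

Lemma cintegrableZ (c : R[i]) f : cintegrable f ->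
  cintegrable (fun x => c * f x).
Proof.
move=> [f1 f2]; split.
- under eq_fun do rewrite ReM.
  by apply: rintegrableB; exact: rintegrableZ.
- under eq_fun do rewrite ImM.
  by apply: rintegrableD; exact: rintegrableZ.
Qed.

Lemma cintegrableD f g : cintegrable f -> cintegrable g ->
  cintegrable (fun x => f x + g x).
Proof.
move=> [f1 f2] [g1 g2]; split.
- by under eq_fun do rewrite ReD; exact: rintegrableD.
- by under eq_fun do rewrite ImD; exact: rintegrableD.
Qed.

Lemma cexpect_real h : cexpect (fun x => (h x)%:C) = (\int[mu]_x h x)%:C.
Proof. by rewrite /cexpect /= Rintegral_cst// mul0r. Qed.

Lemma rintegrable_cst (c : R) : rintegrable (fun=> c).
Proof. exact: finite_measure_integrable_cst. Qed.

Lemma cexpect_cst (c : R[i]) : cexpect (fun=> c) = c.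
Proof.
have I1 (a : R) : \int[mu]_x a = a.
  by rewrite Rintegral_cst//; move: (probability_setT mu) => /= ->; rewrite mulr1.
by rewrite /cexpect !I1; case: c.
Qed.

End complex_expectation.

(** * Second-order expansion of the Stieltjes transform *)

Section resolvent.
Context {R : realType}.
Implicit Types (u v : R[i]) (x : R).
Local Open Scope complex_scope.

Lemma sub_real_neq0 u x : 0 < Im u -> u - x%:C != 0.
Proof.
move=> u0; apply: contraTN u0 => /eqP/(congr1 (@complex.Im R)).
by rewrite ImB/= subr0 => ->; rewrite ltxx.
Qed.

Lemma upper_neq0 u : 0 < Im u -> u != 0.
Proof. by move=> u0; apply: contraTN u0 => /eqP ->; rewrite ltxx. Qed.

Lemma Im_le_abs_sub u x : Im u <= abs (u - x%:C).
Proof.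
by apply: le_trans (Im_le_abs _); rewrite ImB /= subr0 ler_norm.
Qed.

Lemma abs_resolvent_le u x y : 0 < y -> y <= Im u ->
  abs (u - x%:C)^-1 <= y^-1.
Proof.
move=> y0 yu; rewrite absV lef_pV2 ?posrE ?(le_trans yu)// ?Im_le_abs_sub//.
by rewrite (lt_le_trans y0)// (le_trans yu)// Im_le_abs_sub.
Qed.

Lemma cmeasurable_resolvent u : 0 < Im u ->
  cmeasurable (fun x => (u - x%:C)^-1).
Proof.
move=> u0; apply: cmeasurableV => [x|]; first exact: sub_real_neq0.
apply: cmeasurableD; first exact: cmeasurable_cst.
by apply: cmeasurableN; exact: (@cmeasurable_real R id).
Qed.

(** Two steps of the geometric expansion of the resolvent at infinity, with exact
    remainder; integrating it turns the mean and the variance into information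
    on the Stieltjes transform. *)
Lemma resolvent_expand u x : 0 < Im u ->
  (x%:C - u)^-1 =
  - u^-1 + (- (u ^+ 2)^-1 * x%:C + - (u ^+ 2)^-1 * ((x ^+ 2)%:C * (u - x%:C)^-1)).
Proof.
move=> u0; have a := sub_real_neq0 x u0; have b := upper_neq0 u0.
have -> : x%:C - u = - (u - x%:C) by rewrite opprB.
by rewrite rmorphXn /=; field; rewrite a.
Qed.
End resolvent.

Section moments.
Context {R : realType}.
Context (mu : real_law R).
Local Open Scope complex_scope.
Context (mean0 : ('E_mu[id] = 0)%E).
Context (var1 : ('V_mu[id] = 1)%E).

Let integral_sqr : (\int[mu]_x (x ^+ 2)%:E = 1)%E.
Proof.
move: var1; rewrite /variance unlock mean0 /= unlock => <-.
by apply: eq_integral => x _; rewrite -[RHS]/((x - 0) * (x - 0))%:E subr0 expr2.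
Qed.

Lemma rintegrable_sqr : rintegrable mu (fun x => x ^+ 2).
Proof.
apply/integrableP; split.
  by apply/measurable_EFinP; exact: measurable_funX.
under eq_integral do rewrite /= ger0_norm ?sqr_ge0//.
by rewrite integral_sqr ltry.
Qed.

Lemma Rintegral_sqr : \int[mu]_x (x ^+ 2) = 1.
Proof. by rewrite /Rintegral integral_sqr. Qed.

Lemma rintegrable_id : rintegrable mu id.
Proof.
apply: (@rintegrable_dom _ _ _ (fun x => 1 + x ^+ 2)) => // [x|].
  by rewrite ler_norml; apply/andP; split; nra.
by apply: rintegrableD (rintegrable_cst _ _) rintegrable_sqr.
Qed.

Lemma Rintegral_id : \int[mu]_x x = 0.
Proof. by move: mean0; rewrite unlock /Rintegral => ->. Qed.
End moments.

Section second_moment_transform.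
Context {R : realType}.
Context (mu : real_law R).
Local Open Scope complex_scope.
Context (mean0 : ('E_mu[id] = 0)%E).
Context (var1 : ('V_mu[id] = 1)%E).
Implicit Types (u v : R[i]) (x y : R).

Let isqr := rintegrable_sqr mean0 var1.

(** The Cauchy transform of the measure [x^2 mu(dx)], a probability measure when
    the second moment is one. *)
Definition sqr_resolvent u : R[i] :=
  cexpect mu (fun x => (x ^+ 2)%:C * (u - x%:C)^-1).

(** Minus the divided difference of [sqr_resolvent] at [u] and [v]. *)
Definition sqr_resolvent2 u v : R[i] :=
  cexpect mu (fun x => (x ^+ 2)%:C * ((u - x%:C)^-1 * (v - x%:C)^-1)).

(** Controls the error in replacing [x^2 mu(dx)] by a point mass at 0 when
    looking from distance [y]. *)
Definition truncated_moment y : R :=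
  \int[mu]_x (x ^+ 2 * Num.min 1 (`|x| / y)).

Lemma cmeasurable_sqr : cmeasurable (fun x : R => (x ^+ 2)%:C).
Proof. by apply: cmeasurable_real; exact: measurable_funX. Qed.

Lemma abs_sqr x : abs ((x ^+ 2)%:C) = x ^+ 2.
Proof. by rewrite abs_real ger0_norm ?sqr_ge0. Qed.

(** Bounded factors of [x^2] give integrable functions because the second moment
    is finite. *)
Lemma cexpect_sqr_bound (g : R -> R[i]) (b : R) : cmeasurable g ->
  (forall x, abs (g x) <= b) ->
  cintegrable mu (fun x => (x ^+ 2)%:C * g x) /\
  abs (cexpect mu (fun x => (x ^+ 2)%:C * g x)) <= 2 * b.
Proof.
move=> mg gb.
have mf : cmeasurable (fun x => (x ^+ 2)%:C * g x).
  by apply: cmeasurableM => //; exact: cmeasurable_sqr.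
have fb x : abs ((x ^+ 2)%:C * g x) <= b * x ^+ 2.
  by rewrite absM abs_sqr mulrC ler_wpM2r ?sqr_ge0.
have ib : rintegrable mu (fun x => b * x ^+ 2) by exact: rintegrableZ.
split; first exact: cintegrable_dom ib.
by rewrite (le_trans (abs_cexpect_le mf fb ib))// RintegralZl// Rintegral_sqr// mulr1.
Qed.

Lemma measurable_truncation y :
  measurable_fun (setT : set (measurableTypeR R)) (fun x : R => Num.min 1 (`|x| / y)).
Proof.
apply: measurable_minr; first exact: measurable_cst.
by apply: measurable_funM; [exact: normr_measurable|exact: measurable_cst].
Qed.

Lemma truncation_ge0 x y : 0 < y -> 0 <= Num.min 1 (`|x| / y).
Proof. by move=> y0; rewrite le_min ler01/= divr_ge0// ltW. Qed.

Lemma truncated_moment_ge0 y : 0 < y -> 0 <= truncated_moment y.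
Proof.
move=> y0; apply: Rintegral_ge0 => x _.
by rewrite mulr_ge0 ?sqr_ge0// truncation_ge0.
Qed.

Lemma rintegrable_truncation y : 0 < y ->
  rintegrable mu (fun x => x ^+ 2 * Num.min 1 (`|x| / y)).
Proof.
move=> y0; apply: rintegrable_dom isqr.
  by apply: measurable_funM; [exact: measurable_funX|exact: measurable_truncation].
move=> x; rewrite (ger0_norm (mulr_ge0 (sqr_ge0 _) (truncation_ge0 x y0))).
by rewrite ler_piMr ?sqr_ge0// ge_min lexx.
Qed.

Lemma cexpect_sqr_truncated (g : R -> R[i]) (b y : R) : 0 < y -> cmeasurable g ->
  (forall x, abs (g x) <= b * Num.min 1 (`|x| / y)) ->
  abs (cexpect mu (fun x => (x ^+ 2)%:C * g x)) <= 2 * (b * truncated_moment y).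
Proof.
move=> y0 mg gb.
have mf : cmeasurable (fun x => (x ^+ 2)%:C * g x).
  by apply: cmeasurableM => //; exact: cmeasurable_sqr.
have fb x : abs ((x ^+ 2)%:C * g x) <= b * (x ^+ 2 * Num.min 1 (`|x| / y)).
  by rewrite absM abs_sqr mulrCA ler_wpM2l ?sqr_ge0.
have ib := rintegrableZ b (rintegrable_truncation y0).
by rewrite (le_trans (abs_cexpect_le mf fb ib))// RintegralZl//; exact: rintegrable_truncation.
Qed.

Lemma sqr_resolvent_le u y : 0 < y -> y <= Im u -> abs (sqr_resolvent u) <= 2 / y.
Proof.
move=> y0 yu; apply: (cexpect_sqr_bound _ _).2 => [|x].
  exact/cmeasurable_resolvent/(lt_le_trans y0).
exact: abs_resolvent_le.
Qed.

Lemma cmeasurable_resolvent2 u v : 0 < Im u -> 0 < Im v ->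
  cmeasurable (fun x => (u - x%:C)^-1 * (v - x%:C)^-1).
Proof. by move=> u0 v0; apply: cmeasurableM; exact: cmeasurable_resolvent. Qed.

Lemma abs_resolvent2_le u v x y : 0 < y -> y <= Im u -> y <= Im v ->
  abs ((u - x%:C)^-1 * (v - x%:C)^-1) <= (y ^+ 2)^-1.
Proof.
move=> y0 yu yv; rewrite absM expr2 invfM.
by apply: ler_pM; rewrite ?abs_ge0// abs_resolvent_le.
Qed.

Lemma sqr_resolvent2_le u v y : 0 < y -> y <= Im u -> y <= Im v ->
  abs (sqr_resolvent2 u v) <= 2 / y ^+ 2.
Proof.
move=> y0 yu yv; apply: (cexpect_sqr_bound _ _).2 => [|x].
  by apply: cmeasurable_resolvent2; exact: lt_le_trans y0 _.
exact: abs_resolvent2_le.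
Qed.

Lemma cintegrable_sqr_resolvent u : 0 < Im u ->
  cintegrable mu (fun x => (x ^+ 2)%:C * (u - x%:C)^-1).
Proof.
move=> u0; apply: (cexpect_sqr_bound _ _).1 => [|x].
  exact: cmeasurable_resolvent.
exact: (abs_resolvent_le _ u0).
Qed.

Lemma cintegrable_sqr_resolvent2 u v : 0 < Im u -> 0 < Im v ->
  cintegrable mu (fun x => (x ^+ 2)%:C * ((u - x%:C)^-1 * (v - x%:C)^-1)).
Proof.
move=> u0 v0; have m0 : 0 < Num.min (Im u) (Im v) by rewrite lt_min u0.
apply: (cexpect_sqr_bound _ _).1 => [|x]; first exact: cmeasurable_resolvent2.
by apply: (abs_resolvent2_le _ m0); rewrite ge_min lexx ?orbT.
Qed.

Lemma sqr_resolventB u v : 0 < Im u -> 0 < Im v ->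
  sqr_resolvent u - sqr_resolvent v = - (u - v) * sqr_resolvent2 u v.
Proof.
move=> u0 v0; rewrite /sqr_resolvent2 -cexpectZ; last exact: cintegrable_sqr_resolvent2.
rewrite /sqr_resolvent -[X in _ - X]mul1r -mulNr -cexpectZ; last exact: cintegrable_sqr_resolvent.
rewrite -cexpectD; last 2 first.
- exact: cintegrable_sqr_resolvent.
- by apply: cintegrableZ; exact: cintegrable_sqr_resolvent.
congr (cexpect _ _); apply/funext => x.
have a := sub_real_neq0 x u0; have b := sub_real_neq0 x v0.
by field; rewrite a b.
Qed.

(** The linear term of the expansion integrates to zero by centering. *)
Lemma stieltjes_expand u : 0 < Im u ->
  stieltjes mu u = - u^-1 - sqr_resolvent u / u ^+ 2.
Proof.
move=> u0; rewrite -[LHS]/(cexpect mu (fun x => (x%:C - u)^-1)).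
have -> : (fun x => (x%:C - u)^-1) = (fun x => - u^-1 + (- (u ^+ 2)^-1 * x%:C
     + - (u ^+ 2)^-1 * ((x ^+ 2)%:C * (u - x%:C)^-1))).
  by apply/funext => x; exact: resolvent_expand.
have i1 : cintegrable mu (fun x => x%:C).
  split => /=; [exact: rintegrable_id mean0 var1|exact: rintegrable_cst].
have i2 := cintegrable_sqr_resolvent u0.
rewrite cexpectD; last 2 first.
- by split; exact: rintegrable_cst.
- by apply: cintegrableD; exact: cintegrableZ.
rewrite cexpect_cst cexpectD; [|exact: cintegrableZ..].
rewrite !cexpectZ// (cexpect_real _ id) Rintegral_id// mulr0 add0r.
by rewrite -/(sqr_resolvent u) mulNr mulrC.
Qed.

End second_moment_transform.

(** * The reciprocal transform far from the real axis *)

Section reciprocal_transform.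
Context {R : realType}.
Context (mu : real_law R).
Local Open Scope complex_scope.
Context (mean0 : ('E_mu[id] = 0)%E).
Context (var1 : ('V_mu[id] = 1)%E).
Implicit Types (u v : R[i]) (x y : R).
Local Notation A := (sqr_resolvent mu).
Local Notation T := (truncated_moment mu).

(** The bound is uniform in the sector [|u| <= K y <= K Im u]: for large [x] the
    quotient is bounded by [1 + K], for small [x] by [|x| / y]. *)
Lemma real_resolvent_le u x y (K : R) : 0 < y -> y <= Im u -> abs u <= K * y ->
  abs (x%:C * (u - x%:C)^-1) <= (1 + K) * Num.min 1 (`|x| / y).
Proof.
move=> y0 yu uK; have d := le_trans yu (Im_le_abs_sub u x).
have K0 : 0 <= K by rewrite -(pmulr_lge0 _ y0) (le_trans _ uK)// abs_ge0.
have d0 := lt_le_trans y0 d.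
rewrite absM absV abs_real.
have [H|H] := leP 1 (`|x| / y).
- rewrite mulr1 ler_pdivrMr//.
  have : `|x| <= abs u + abs (u - x%:C).
    by rewrite -abs_real (le_trans _ (absB _ _))// opprB addrC subrK.
  by move=> /le_trans; apply; nra.
- apply: (@le_trans _ _ (`|x| / y)).
    by apply: ler_wpM2l => //; rewrite lef_pV2 ?posrE.
  by rewrite ler_peMl ?divr_ge0 ?(ltW y0)// lerDl.
Qed.

Lemma sqr_resolvent_asymp u y (K : R) : 0 < y -> y <= Im u -> abs u <= K * y ->
  abs (u * A u - 1) <= 2 * ((1 + K) * T y).
Proof.
move=> y0 yu uK; have u0 := lt_le_trans y0 yu.
have i1 := cintegrable_sqr_resolvent mean0 var1 u0.
have i2 : cintegrable mu (fun x => (x ^+ 2)%:C).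
  by split => /=; [exact: rintegrable_sqr|exact: rintegrable_cst].
have -> : u * A u - 1 =
    cexpect mu (fun x => (x ^+ 2)%:C * (x%:C * (u - x%:C)^-1)).
  rewrite -[X in _ - X](_ : cexpect mu (fun x => (x ^+ 2)%:C) = 1); last first.
    by rewrite cexpect_real Rintegral_sqr.
  rewrite -[X in _ - X]mul1r -mulNr -!cexpectZ// -cexpectD; [|exact: cintegrableZ..].
  congr (cexpect _ _); apply/funext => x.
  by have a := sub_real_neq0 x u0; field.
apply: cexpect_sqr_truncated => //.
  apply: cmeasurableM; first exact: (@cmeasurable_real R id).
  exact: cmeasurable_resolvent.
by move=> x; exact: real_resolvent_le.
Qed.

(** With [r = x / (u - x)] and [r'] likewise, [u v / ((u - x) (v - x))] equals
    [(1 + r) (1 + r')], so only terms containing some [r] remain after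
    subtracting 1. *)
Lemma sqr_resolvent2_asymp u v y (K : R) : 0 < y -> y <= Im u -> y <= Im v ->
  abs u <= K * y -> abs v <= K * y ->
  abs (u * v * sqr_resolvent2 mu u v - 1) <= 2 * (3 * (1 + K) ^+ 2 * T y).
Proof.
move=> y0 yu yv uK vK; have u0 := lt_le_trans y0 yu.
have v0 := lt_le_trans y0 yv.
have K0 : 0 <= K by rewrite -(pmulr_lge0 _ y0) (le_trans _ uK)// abs_ge0.
have i1 := cintegrable_sqr_resolvent2 mean0 var1 u0 v0.
have i2 : cintegrable mu (fun x => (x ^+ 2)%:C).
  by split => /=; [exact: rintegrable_sqr|exact: rintegrable_cst].
pose r (w : R[i]) x := x%:C * (w - x%:C)^-1.
have mr w : 0 < Im w -> cmeasurable (r w).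
  move=> w0; apply: cmeasurableM; first exact: (@cmeasurable_real R id).
  exact: cmeasurable_resolvent.
have -> : u * v * sqr_resolvent2 mu u v - 1 =
    cexpect mu (fun x => (x ^+ 2)%:C * (r u x + (r v x + r u x * r v x))).
  rewrite -[X in _ - X](_ : cexpect mu (fun x => (x ^+ 2)%:C) = 1); last first.
    by rewrite cexpect_real Rintegral_sqr.
  rewrite -[X in _ - X]mul1r -mulNr -!cexpectZ// -cexpectD; [|exact: cintegrableZ..].
  congr (cexpect _ _); apply/funext => x; rewrite /r.
  have a := sub_real_neq0 x u0; have b := sub_real_neq0 x v0.
  by field; rewrite a b.
apply: cexpect_sqr_truncated => //.
  by apply: cmeasurableD; [|apply: cmeasurableD; [|apply: cmeasurableM]]; exact: mr.
move=> x; have ru := real_resolvent_le x y0 yu uK.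
have rv := real_resolvent_le x y0 yv vK.
apply: le_trans (absD _ _) _.
have H : abs (r v x + r u x * r v x) <= abs (r v x) + abs (r u x) * abs (r v x).
  by apply: le_trans (absD _ _) _; rewrite absM.
have t0 := truncation_ge0 x y0.
have t1 : Num.min 1 (`|x| / y) <= 1 by rewrite ge_min lexx.
have := abs_ge0 (r u x); have := abs_ge0 (r v x).
move: (abs (r v x + _)) H ru rv.
rewrite -/(r u x) -/(r v x).
move: (abs (r u x)) (abs (r v x)) (Num.min _ _) t0 t1 => a b t t0 t1 p H ru rv b0 a0.
have : a * b <= (1 + K) ^+ 2 * t.
  apply: (@le_trans _ _ ((1 + K) * t * ((1 + K) * t))); first exact: ler_pM.
  rewrite (_ : _ * _ = (1 + K) ^+ 2 * t * t); last by ring.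
  by rewrite ler_piMr// mulr_ge0// sqr_ge0.
have : (1 + K) * t <= (1 + K) ^+ 2 * t by rewrite ler_wpM2r// expr2; nra.
lra.
Qed.

(** [F u - u], with [F = -1/m] the reciprocal Cauchy transform. *)
Definition excess u : R[i] := - (stieltjes mu u)^-1 - u.

(** With [A = sqr_resolvent], the expansion of [m] gives [F u = u^2 / (u + A u)],
    hence [F u - u = - A u + correction u]. *)
Definition correction u : R[i] := A u ^+ 2 / (u + A u).

Lemma ge8_gt0 y : 8 <= y -> 0 < y. Proof. lra. Qed.

(** [A u] has modulus at most [1/4] while [u] has modulus at least 8. *)
Lemma perturbed_ge y (y8 : 8 <= y) u : y <= Im u -> y / 2 <= abs (u + A u).
Proof.
have y0 := ge8_gt0 y8.
move=> yu; have := le_abs_of_Im yu; have := sqr_resolvent_le mean0 var1 y0 yu.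
have : 2 / y <= 2 / 8 by rewrite ler_wpM2l// lef_pV2 ?posrE.
have : abs u <= abs (u + A u) + abs (A u).
  by rewrite -{1}(addrK (A u) u) absB.
lra.
Qed.

Lemma perturbed_neq0 y (y8 : 8 <= y) u : y <= Im u -> u + A u != 0.
Proof.
have y0 := ge8_gt0 y8.
move=> yu; apply/eqP => h; have := perturbed_ge y8 yu; rewrite h abs0; lra.
Qed.

Lemma excessE y (y8 : 8 <= y) u : y <= Im u -> excess u = correction u - A u.
Proof.
have y0 := ge8_gt0 y8.
move=> yu; have u0 := upper_neq0 (lt_le_trans y0 yu).
have a := perturbed_neq0 y8 yu.
rewrite /excess /correction stieltjes_expand//; last exact: lt_le_trans yu.
have -> : - u^-1 - A u / u ^+ 2 = - ((u + A u) / u ^+ 2) by field.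
by field; rewrite u0 a.
Qed.

Lemma correction_le y (y8 : 8 <= y) u : y <= Im u -> abs (correction u) <= 8 / y ^+ 3.
Proof.
have y0 := ge8_gt0 y8.
move=> yu; rewrite (_ : 8 / _ = ((2 / y) ^+ 2) / (y / 2)); last by field; lra.
apply: abs_div_le; [|lra|exact: (perturbed_ge y8)].
by rewrite !expr2 absM; apply: ler_pM; rewrite ?abs_ge0// (sqr_resolvent_le mean0 var1 y0).
Qed.

Lemma sqr_resolvent_lip y (y8 : 8 <= y) u v : y <= Im u -> y <= Im v ->
  abs (A u - A v) <= 2 / y ^+ 2 * abs (u - v).
Proof.
have y0 := ge8_gt0 y8.
move=> yu yv; rewrite (sqr_resolventB mean0 var1); [|exact: lt_le_trans yu|exact: lt_le_trans yv].
rewrite absM absN mulrC ler_wpM2r ?abs_ge0//; exact: (sqr_resolvent2_le mean0 var1 y0).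
Qed.

Lemma correction_lip y (y8 : 8 <= y) u v : y <= Im u -> y <= Im v ->
  abs (correction u - correction v) <= 48 / y ^+ 4 * abs (u - v).
Proof.
have y0 := ge8_gt0 y8.
move=> yu yv; have a := perturbed_neq0 y8 yu; have b := perturbed_neq0 y8 yv.
have -> : correction u - correction v = (A u - A v) * (A u + A v) / (u + A u) -
    A v ^+ 2 * ((u - v) + (A u - A v)) / ((u + A u) * (v + A v)).
  by rewrite /correction; field; rewrite a b.
have L := sqr_resolvent_lip y8 yu yv.
set d := abs (u - v) in L *; have d0 : 0 <= d by exact: abs_ge0.
have i0 : 0 < y^-1 by rewrite invr_gt0.
have i1 : y^-1 <= 8^-1 by rewrite lef_pV2 ?posrE//.
apply: (@le_trans _ _ ((2 / y ^+ 2 * d * (4 / y)) / (y / 2)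
   + ((2 / y) ^+ 2 * (2 * d)) / (y / 2 * (y / 2)))); last first.
  have -> : 48 / y ^+ 4 * d = 2 / y ^+ 2 * d * (4 / y) / (y / 2)
   + (2 / y) ^+ 2 * (2 * d) / (y / 2 * (y / 2)); last exact: lexx.
  by field; lra.
apply: le_trans (absB _ _) _; apply: lerD.
- apply: abs_div_le; [|lra|exact: (perturbed_ge y8)].
  rewrite absM; apply: ler_pM; rewrite ?abs_ge0//.
  apply: le_trans (absD _ _) _; have := sqr_resolvent_le mean0 var1 y0 yu.
  by have := sqr_resolvent_le mean0 var1 y0 yv; lra.
- apply: abs_div_le; last 2 first.
  + by apply: mulr_gt0; lra.
  + by rewrite absM; apply: ler_pM; rewrite ?(perturbed_ge y8)//; lra.
  rewrite absM; apply: ler_pM; rewrite ?abs_ge0//.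
    by rewrite !expr2 absM; apply: ler_pM; rewrite ?abs_ge0// (sqr_resolvent_le mean0 var1 y0).
  apply: le_trans (absD _ _) _; rewrite -/d.
  have : 2 / y ^+ 2 * d <= 1 * d.
    apply: ler_wpM2r => //; rewrite expr2 invfM; nra.
  lra.
Qed.

Lemma excess_le y (y8 : 8 <= y) u : y <= Im u -> abs (excess u) <= 4 / y.
Proof.
have y0 := ge8_gt0 y8.
move=> yu; rewrite (excessE y8)//; apply: le_trans (absB _ _) _.
have := sqr_resolvent_le mean0 var1 y0 yu; have := correction_le y8 yu.
have i0 : 0 < y^-1 by rewrite invr_gt0.
have i1 : y^-1 <= 8^-1 by rewrite lef_pV2 ?posrE//.
have -> : 8 / y ^+ 3 = 8 * y^-1 * (y^-1 * y^-1) by field; lra.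
have : y^-1 * y^-1 <= 8^-1 * 8^-1 by nra.
nra.
Qed.

(** A contraction constant below 1 is what makes [F = id + excess] injective. *)
Lemma excess_lip y (y8 : 8 <= y) u v : y <= Im u -> y <= Im v ->
  abs (excess u - excess v) <= 2^-1 * abs (u - v).
Proof.
have y0 := ge8_gt0 y8.
move=> yu yv; rewrite !(excessE y8)//.
have -> : correction u - A u - (correction v - A v) =
  (correction u - correction v) - (A u - A v) by ring.
apply: le_trans (absB _ _) _.
have := sqr_resolvent_lip y8 yu yv; have := correction_lip y8 yu yv.
have i0 : 0 < y^-1 by rewrite invr_gt0.
have i1 : y^-1 <= 8^-1 by rewrite lef_pV2 ?posrE//.
have -> : 48 / y ^+ 4 = 48 * (y^-1 ^+ 2) ^+ 2 by field; lra.
have -> : 2 / y ^+ 2 = 2 * y^-1 ^+ 2 by field; lra.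
have : y^-1 ^+ 2 <= 64^-1 by nra.
have : 0 <= y^-1 ^+ 2 by exact: sqr_ge0.
move: (y^-1 ^+ 2) (abs_ge0 (u - v)) => s d0 s0 s1.
have : s ^+ 2 <= 64^-1 * s by nra.
nra.
Qed.

(** [m u = m v] says [F u = F v], so [excess] moves [u - v] to its opposite,
    which a strict contraction allows only for [u = v]. *)
Lemma stieltjes_injective_high y (y8 : 8 <= y) u v : y <= Im u -> y <= Im v ->
  stieltjes mu u = stieltjes mu v -> u = v.
Proof.
have y0 := ge8_gt0 y8.
move=> yu yv uv; have := excess_lip y8 yu yv.
have -> : excess u - excess v = - (u - v) by rewrite /excess uv; ring.
rewrite absN => h; apply/eqP; rewrite -subr_eq0; apply/eqP/abs_eq0.
have := abs_ge0 (u - v); lra.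
Qed.

(** Bounds both the size and the Lipschitz constant of [excess u + 1/u], in the
    natural units [1/y] and [1/y^2]. *)
Definition defect_size (K y : R) := 6 * (1 + K) ^+ 2 * T y + 48 / y ^+ 2.

Lemma excess_asymp y (y8 : 8 <= y) u (K : R) : y <= Im u -> abs u <= K * y ->
  abs (excess u + u^-1) <= defect_size K y / y.
Proof.
have y0 := ge8_gt0 y8.
move=> yu uK; rewrite (excessE y8)//; have u0 := upper_neq0 (lt_le_trans y0 yu).
have K0 : 0 <= K by rewrite -(pmulr_lge0 _ y0) (le_trans _ uK)// abs_ge0.
have -> : correction u - A u + u^-1 = correction u - (u * A u - 1) / u by field.
apply: le_trans (absB _ _) _; have := correction_le y8 yu.
have := abs_div_le (sqr_resolvent_asymp y0 yu uK) y0 (le_abs_of_Im yu).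
have -> : 8 / y ^+ 3 = 8 / y ^+ 2 / y by field; lra.
move=> h1 h2; apply: (le_trans (lerD h2 h1)); rewrite -mulrDl ler_wpM2r ?invr_ge0 ?(ltW y0)//.
have : 0 <= (y ^+ 2)^-1 by rewrite invr_ge0 sqr_ge0.
rewrite /defect_size; move: (y ^+ 2)^-1 => s s0.
have : (1 + K) * T y <= (1 + K) ^+ 2 * T y
  by rewrite ler_wpM2r ?(truncated_moment_ge0 mu y0)// expr2; nra.
have : 0 <= (1 + K) ^+ 2 * T y by rewrite mulr_ge0 ?(truncated_moment_ge0 mu y0)// sqr_ge0.
lra.
Qed.

Lemma excess_asymp_lip y (y8 : 8 <= y) u v (K : R) : y <= Im u -> y <= Im v ->
  abs u <= K * y -> abs v <= K * y ->
  abs ((excess u + u^-1) - (excess v + v^-1)) <= defect_size K y / y ^+ 2 * abs (u - v).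
Proof.
have y0 := ge8_gt0 y8.
move=> yu yv uK vK; rewrite !(excessE y8)//.
have u0 := upper_neq0 (lt_le_trans y0 yu).
have v0 := upper_neq0 (lt_le_trans y0 yv).
have -> : correction u - A u + u^-1 - (correction v - A v + v^-1) =
   (correction u - correction v) + (u - v) * ((u * v * sqr_resolvent2 mu u v - 1) / (u * v)).
  have e : A v = A u + (u - v) * sqr_resolvent2 mu u v.
    have := sqr_resolventB mean0 var1 (lt_le_trans y0 yu) (lt_le_trans y0 yv).
    by move=> h; rewrite -[A v](subKr (A u)) h; ring.
  by rewrite e; field; rewrite u0 v0.
apply: le_trans (absD _ _) _; have h1 := correction_lip y8 yu yv.
have yy : y ^+ 2 <= abs (u * v).
  by rewrite absM expr2; apply: ler_pM; rewrite ?le_abs_of_Im// ltW.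
have h2 := abs_div_le (sqr_resolvent2_asymp y0 yu yv uK vK) (exprn_gt0 2 y0) yy.
rewrite absM; set d := abs (u - v) in h1 *; have d0 : 0 <= d by exact: abs_ge0.
apply: le_trans (lerD h1 (ler_wpM2l d0 h2)) _.
rewrite [X in _ + X]mulrC -mulrDl ler_wpM2r//.
have -> : 48 / y ^+ 4 = 48 / y ^+ 2 / y ^+ 2 by field; lra.
by rewrite -mulrDl ler_wpM2r ?invr_ge0 ?sqr_ge0// /defect_size; lra.
Qed.
End reciprocal_transform.

Section truncation_limit.
Context {R : realType}.
Context (mu : real_law R).
Context (mean0 : ('E_mu[id] = 0)%E).
Context (var1 : ('V_mu[id] = 1)%E).
Local Notation T := (truncated_moment mu).

Lemma truncated_moment_decr y z : 0 < y -> y <= z -> T z <= T y.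
Proof.
move=> y0 yz; have z0 := lt_le_trans y0 yz.
apply: le_Rintegral => //; [exact: rintegrable_truncation..|] => x _.
rewrite ler_wpM2l ?sqr_ge0// le_min !ge_min lexx/=.
by apply/orP; right; rewrite ler_wpM2l// lef_pV2.
Qed.

(** Dominated convergence with dominating function [x^2]. *)
Lemma truncated_moment_cvg : T n.+1%:R @[n --> \oo] --> 0.
Proof.
pose f (n : nat) (x : measurableTypeR R) := (x ^+ 2 * Num.min 1 (`|x| / n.+1%:R))%:E.
have mf n : measurable_fun setT (f n).
  apply/measurable_EFinP; apply: measurable_funM; first exact: measurable_funX.
  exact: measurable_truncation.
have isq : mu.-integrable setT (fun x => (x ^+ 2)%:E).
  exact: rintegrable_sqr mean0 var1.
have [|||_ _] := @dominated_convergence _ _ _ mu setT measurableT f (cst 0%E)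
  (fun x => (x ^+ 2)%:E) mf _ _ isq _.
- exact: measurable_cst.
- apply: aeW => x _; rewrite /f; apply/fine_cvgP; split; first by near=> n.
  rewrite /comp /=.
  apply: (@squeeze_cvgr _ _ _ _ (cst 0) (fun n : nat => x ^+ 2 * `|x| * n.+1%:R^-1)).
  + near=> n; rewrite mulr_ge0 ?sqr_ge0 ?truncation_ge0//=.
    by rewrite -mulrA ler_wpM2l ?sqr_ge0// ge_min lexx orbT.
  + exact: cvg_cst.
  + rewrite -[X in _ --> X](mulr0 (x ^+ 2 * `|x|)).
    by apply: cvgM; [exact: cvg_cst|exact: cvg_harmonic].
- apply: aeW => x n _; rewrite /f /= lee_fin.
  rewrite (ger0_norm (mulr_ge0 (sqr_ge0 _) (truncation_ge0 x (ltr0Sn _ n)))).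
  by rewrite ler_piMr ?sqr_ge0// ge_min lexx.
- rewrite integral0 => /fine_cvgP[_]; exact.
Unshelve. all: by end_near.
Qed.

Lemma truncated_moment_small (e : R) : 0 < e ->
  exists2 Y, 0 < Y & forall y, Y <= y -> T y <= e.
Proof.
move=> e0; have /cvgrPdist_le/(_ e e0)[N _ H] := truncated_moment_cvg.
exists N.+1%:R => // y Ny; have := H N (leqnn N).
rewrite /= sub0r normrN => h.
by rewrite (le_trans (truncated_moment_decr _ Ny))// (le_trans (ler_norm _) h).
Qed.

Lemma defect_size_small (K e : R) : 0 < e -> 
  exists Y, forall y, Y <= y -> 8 <= y /\ defect_size mu K y <= e.
Proof.
move=> e0; pose b := 6 * (1 + K) ^+ 2 + 1.
have b0 : 0 < b by rewrite /b; have := sqr_ge0 (1 + K); lra.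
have [Y Y0 H] := truncated_moment_small (divr_gt0 e0 (mulr_gt0 (ltr0Sn R 1) b0)).
exists (Num.max Y (Num.max 8 (96 / e))) => y; rewrite !ge_max => /and3P[yY y8 ye].
split => //; rewrite /defect_size.
have y0 := lt_le_trans Y0 yY.
have t := H y yY; have t0 := truncated_moment_ge0 mu y0.
have h1 : b * T y <= e / 2.
  apply: le_trans (ler_wpM2l (ltW b0) t) _.
  by rewrite le_eqVlt; apply/orP; left; apply/eqP; field; rewrite gt_eqF.
have h2 : 48 / y ^+ 2 <= e / 2.
  rewrite ler_pdivrMr ?exprn_gt0//; move: ye; rewrite ler_pdivrMr// => ye.
  by rewrite expr2; nra.
have : 6 * (1 + K) ^+ 2 * T y <= b * T y by rewrite ler_wpM2r// /b; lra.
lra.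
Qed.
End truncation_limit.

(** * Subordination preimages of a free power *)

Section free_powers.
Context {R : realType}.
Implicit Types (omega : R[i] -> R[i]) (z : R[i]).

(** Continuity of a map on the upper half-plane, spelled out with the real-valued
    modulus. *)
Definition upper_continuous omega := forall z, 0 < Im z -> forall e : R, 0 < e ->
  exists2 d : R, 0 < d & forall w, abs (w - z) < d -> abs (omega w - omega z) < e.

Lemma normE z : `|z| = (abs z)%:C%C.
Proof. by rewrite normc_def absE. Qed.

Lemma analytic_upper_continuous omega :
  analytic_on_upper omega -> upper_continuous omega.
Proof.
move=> h z z0 e e0; have /derivable1_diffP/differentiable_continuous := h z z0.
move=> /(@cvgrPdist_lt _ _ _ _ _)/(_ e%:C%C).
rewrite -[0 < _]/(0%:C%C < _) ltcR => /(_ e0)/nbhs_ballP[d /=].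
move=> d0; have [d' dE] : exists d', d = d'%:C%C.
  by exists (Re d); case: d d0 => a b; rewrite ltcE /= => /andP[/eqP -> _].
move: d0; rewrite dE -[0 < _]/(0%:C%C < _) ltcR => d0 H; exists d' => // w wd.
have := H w; rewrite /ball /= distrC normE ltcR => /(_ wd).
by rewrite distrC normE ltcR.
Qed.

Lemma upper_continuous_comp omega omega' : upper_continuous omega ->
  upper_continuous omega' -> (forall z, 0 < Im z -> 0 < Im (omega' z)) ->
  upper_continuous (omega \o omega').
Proof.
move=> c c' p z z0 e e0; have [d d0 H] := c _ (p z z0) e e0.
have [d' d'0 H'] := c' z z0 d d0; exists d' => // w wd.
by apply: H; exact: H'.
Qed.

(** When one more free convolution factor is added, the old preimages are composed
    with the first subordination function and the second subordination function
    is the new preimage.  The sum relation is stated with [n F] on the left and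
    [F] on the right so that no predecessor of [n] appears. *)
Lemma free_power_preimages (mu nu : real_law R) n : is_free_power mu n nu ->
  exists u : nat -> R[i] -> R[i],
  [/\ forall k, (k < n)%N -> upper_continuous (u k),
      forall k z, (k < n)%N -> 0 < Im z -> Im z <= Im (u k z),
      forall k z, (k < n)%N -> 0 < Im z -> stieltjes nu z = stieltjes mu (u k z) &
      forall z, 0 < Im z ->
        z + n%:R * - (stieltjes nu z)^-1 = - (stieltjes nu z)^-1 + \sum_(k < n) u k z].
Proof.
elim=> [{n nu}|{}n {}nu nu' _ [u [cu iu su eu]] [w1 [w2 [[a1 i1 _] [a2 i2 _] H]]]].
  exists (fun _ => id); split=> // [k _ z z0 e e0|z z0].
    by exists e.
  by rewrite big_ord1 mul1r addrC.
have p1 z : 0 < Im z -> 0 < Im (w1 z) by move=> z0; exact: lt_le_trans (i1 z z0).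
(* index [n] is the preimage contributed by the new factor *)
exists (fun k z => if (k < n)%N then u k (w1 z) else w2 z); split.
- move=> k _; case: (boolP (k < n)%N) => kn; last exact: analytic_upper_continuous.
  apply: (@upper_continuous_comp (u k)) => //; first exact: cu.
  exact: analytic_upper_continuous.
- move=> k z _ z0; case: ifPn => kn; last exact: i2.
  by apply: (le_trans (i1 z z0)); apply: iu => //; exact: p1.
- move=> k z _ z0; have [s1 s2 _] := H z z0; case: ifPn => kn //.
  by rewrite s1; apply: su => //; exact: p1.
- move=> z z0; have [s1 s2 s3] := H z z0.
  rewrite big_ord_recr/= ltnn (eq_bigr (fun k : 'I_n => u k (w1 z))); last first.
    by move=> k _; rewrite ltn_ord.
  have := eu _ (p1 z z0); rewrite -s1 => e1.
  rewrite addrA -e1 addrAC -s3 -natr1; ring.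
Qed.
End free_powers.

(** * Perturbed Joukowsky equation in the bulk *)

Section joukowsky.
Context {R : realType}.
Implicit Types (s z : R[i]).
Local Open Scope complex_scope.

(** Let [a + i b = s] and [p = 1/|s|^2].  The lower bound on [Im z] forces
    [p <= 2].  From [(a^2 + b^2) (1 + p)^2 = 1/p + 2 + p >= 4] and
    [(a (1 + p))^2 = (Re z)^2 <= r^2] one gets [9 b^2 >= 4 - r^2]. *)
Lemma joukowsky_gap s z (c r : R) : 0 < c -> c <= Im s -> s + s^-1 = z ->
  `|Re z| <= r -> - c <= Im z -> 36 * c ^+ 2 <= 4 - r ^+ 2 -> 2 * c <= Im s.
Proof.
move=> c0 cs <-; rewrite ReD ImD ReV ImV.
case: s cs => a b /= cb; set q := a ^+ 2 + b ^+ 2.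
have b0 := lt_le_trans c0 cb.
have q0 : 0 < q by rewrite /q ltr_wpDl ?sqr_ge0// exprn_gt0.
set p := q^-1; have qp : q * p = 1 by rewrite divff// gt_eqF.
have p0 : 0 < p by rewrite invr_gt0.
move=> hr him hc.
have p2 : p <= 2 by nra.
have h1 : (a * (1 + p)) ^+ 2 <= r ^+ 2.
  rewrite -[leLHS]real_normK ?num_real// ler_sqr ?nnegrE ?(le_trans _ hr)//.
  by rewrite mulrDr mulr1.
have h2 : (a * (1 + p)) ^+ 2 = q + 2 + p - (b * (1 + p)) ^+ 2.
  have -> : q + 2 + p = q * (1 + p) ^+ 2.
    rewrite (_ : q * (1 + p) ^+ 2 = q + 2 * (q * p) + (q * p) * p); last by ring.
    by rewrite qp; ring.
  by rewrite /q; ring.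
have h3 : 2 <= q + p.
  have : 0 <= (q - 1) ^+ 2 * p by rewrite mulr_ge0 ?sqr_ge0// ltW.
  rewrite (_ : (q - 1) ^+ 2 * p = q * (q * p) - 2 * (q * p) + p); last by ring.
  by rewrite qp; lra.
have h4 : (b * (1 + p)) ^+ 2 <= 9 * b ^+ 2.
  rewrite exprMn mulrC ler_wpM2r ?sqr_ge0//; nra.
have : (2 * c) ^+ 2 <= b ^+ 2 by rewrite exprMn; lra.
by rewrite ler_sqr ?nnegrE; lra.
Qed.

(** The difference of the two values factors as [(s - z) (s - 1/z) / s], and
    [1/z] lies in the closed lower half-plane, at distance at least [c] from [s]. *)
Lemma joukowsky_stable s z (c K : R) : 0 < c -> c <= Im s -> 0 <= Im z ->
  z != 0 -> abs s <= K * c ->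
  abs (s - z) <= K * abs ((s + s^-1) - (z + z^-1)).
Proof.
move=> c0 cs zi z0 sK; have s0 := upper_neq0 (lt_le_trans c0 cs).
have e : s * ((s + s^-1) - (z + z^-1)) = (s - z) * (s - z^-1).
  by field; rewrite s0 z0.
have h : c <= abs (s - z^-1).
  apply: le_trans (le_trans (ler_norm _) (Im_le_abs _)).
  rewrite ImB ImV opprK; apply: (le_trans cs); rewrite lerDl.
  by rewrite divr_ge0// addr_ge0// sqr_ge0.
rewrite -(ler_pM2r c0); apply: (@le_trans _ _ (abs (s - z) * abs (s - z^-1))).
  by rewrite ler_wpM2l ?abs_ge0.
by rewrite -absM -e absM [K * _ * c]mulrAC ler_wpM2r ?abs_ge0.
Qed.
End joukowsky.

Section bulk.
Context {R : realType}.
Context (mu : real_law R).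
Local Open Scope complex_scope.
Context (mean0 : ('E_mu[id] = 0)%E).
Context (var1 : ('V_mu[id] = 1)%E).

(** Preimages of one value at height [y] coincide by injectivity, after which the
    sum relation determines [z] from the common preimage. *)
Lemma preimages_equal (y : R) n (us : nat -> R[i]) (m z : R[i]) : 8 <= y ->
  (forall k, (k < n)%N -> y <= Im (us k)) ->
  (forall k, (k < n)%N -> m = stieltjes mu (us k)) ->
  z + n%:R * - m^-1 = - m^-1 + \sum_(k < n) us k -> (0 < n)%N ->
  [/\ forall k, (k < n)%N -> us k = us 0%N,
      - m^-1 = us 0%N + excess mu (us 0%N) &
      z = us 0%N - (n%:R - 1) * excess mu (us 0%N)].
Proof.
move=> y8 yu mu_ e n0.
have eq k : (k < n)%N -> us k = us 0%N.
  move=> kn; apply: (stieltjes_injective_high mean0 var1 y8); [exact: yu..|].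
  by rewrite -!mu_.
have F : - m^-1 = us 0%N + excess mu (us 0%N).
  by rewrite /excess -mu_// addrC subrK.
split=> //; move: e; rewrite F.
rewrite (eq_bigr (fun=> us 0%N)) => [|k _]; last exact: eq.
rewrite sumr_const card_ord -[us 0%N *+ n]mulr_natl => e.
by rewrite -[LHS](addrK (n%:R * (us 0%N + excess mu (us 0%N)))) e; ring.
Qed.

(** The error term in [v + 1/v = z + defect w v] for [w = sqrt n].  Its first
    summand makes up for the factor [(n - 1) / n] in front of [1/v]. *)
Definition defect (w : R) (v : R[i]) : R[i] :=
  ((w ^+ 2)%:C * v)^-1 +
  ((w ^+ 2 - 1) / w)%:C * (excess mu (w%:C * v) + (w%:C * v)^-1).

(** Divide the relation between [z] and the common preimage by [w] and separate
    the leading part [- 1/u] of [excess u]. *)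
Lemma defectE (w : R) (v z : R[i]) : 0 < w -> v != 0 ->
  w%:C * z = w%:C * v - ((w ^+ 2)%:C - 1) * excess mu (w%:C * v) ->
  v + v^-1 = z + defect w v.
Proof.
move=> w0 v0 e; have w0' := realC_neq0 w0.
have -> : z = v - ((w ^+ 2)%:C - 1) * excess mu (w%:C * v) / w%:C.
  by apply: (mulfI w0'); rewrite e; field.
rewrite /defect !(rmorphM, rmorphB, rmorphXn, rmorph1, fmorphV)/=.
by field; rewrite w0' v0.
Qed.

Lemma defect_le (w c K eta : R) (v : R[i]) : 0 < c -> 0 < w -> 1 <= w -> 8 <= c * w ->
  defect_size mu K (c * w) <= c * eta / 2 -> (c * w ^+ 2)^-1 <= eta / 2 ->
  c <= Im v -> abs v <= K * c -> abs (defect w v) <= eta.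
Proof.
move=> c0 w0 w1 y8 dK cn cv vK.
have yv : c * w <= Im (w%:C * v) by rewrite Im_scale mulrC ler_wpM2l// ltW.
have vK' : abs (w%:C * v) <= K * (c * w).
  by rewrite abs_scale// mulrC mulrA ler_wpM2r// ltW.
have cv' : c <= abs v by exact: le_abs_of_Im.
have := excess_asymp mean0 var1 y8 yv vK'.
set D := excess _ _ + _ => hD.
have h1 : abs ((w ^+ 2)%:C * v)^-1 <= eta / 2.
  rewrite absV; apply: le_trans cn.
  have v0 := lt_le_trans c0 cv'.
  rewrite abs_scale ?exprn_gt0// lef_pV2 ?posrE ?mulr_gt0 ?exprn_gt0//.
  by rewrite mulrC ler_wpM2l// sqr_ge0.
have h2 : abs (((w ^+ 2 - 1) / w)%:C * D) <= eta / 2.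
  rewrite absM abs_real ger0_norm; last first.
    by rewrite divr_ge0 ?(ltW w0)// subr_ge0 expr_ge1 ?(ltW w0).
  apply: (@le_trans _ _ (w * (c * eta / 2 / (c * w)))); last first.
    by rewrite le_eqVlt; apply/orP; left; apply/eqP; field; rewrite !gt_eqF.
  apply: ler_pM; rewrite ?abs_ge0//.
  - by rewrite divr_ge0 ?(ltW w0)// subr_ge0 expr_ge1 ?(ltW w0).
  - by rewrite ler_pdivrMr// -expr2; lra.
  - by apply: (le_trans hD); rewrite ler_wpM2r// invr_ge0; lra.
rewrite /defect; apply: le_trans (absD _ _) _; lra.
Qed.

Lemma defect_lip (w c K eta : R) (v v' : R[i]) : 0 < c -> 0 < w -> 1 <= w -> 8 <= c * w ->
  defect_size mu K (c * w) <= c * eta / 2 -> (c * w ^+ 2)^-1 <= eta / 2 ->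
  c <= Im v -> abs v <= K * c -> c <= Im v' -> abs v' <= K * c ->
  abs (defect w v - defect w v') <= eta / c * abs (v - v').
Proof.
move=> c0 w0 w1 y8 dK cn cv vK cv' vK'.
have up (x : R[i]) : c <= Im x -> c * w <= Im (w%:C * x).
  by move=> cx; rewrite Im_scale mulrC ler_wpM2l// ltW.
have ab (x : R[i]) : abs x <= K * c -> abs (w%:C * x) <= K * (c * w).
  by move=> xK; rewrite abs_scale// mulrC mulrA ler_wpM2r// ltW.
have ca (x : R[i]) : c <= Im x -> c <= abs x.
  by exact: le_abs_of_Im.
have w0' := realC_neq0 w0.
have v0 := upper_neq0 (lt_le_trans c0 cv).
have v0' := upper_neq0 (lt_le_trans c0 cv').
have := excess_asymp_lip mean0 var1 y8 (up _ cv) (up _ cv') (ab _ vK) (ab _ vK').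
rewrite -mulrBr abs_scale//.
rewrite /defect; set D := excess _ _ + _; set D' := excess _ _ + _ => hD.
set d := abs (v - v') in hD *; have d0 : 0 <= d by exact: abs_ge0.
have -> : ((w ^+ 2)%:C * v)^-1 + ((w ^+ 2 - 1) / w)%:C * D -
   (((w ^+ 2)%:C * v')^-1 + ((w ^+ 2 - 1) / w)%:C * D') =
   - ((v - v') / ((w ^+ 2)%:C * (v * v'))) + ((w ^+ 2 - 1) / w)%:C * (D - D').
  rewrite !(rmorphM, rmorphB, rmorphXn, rmorph1, fmorphV)/=.
  by field; rewrite w0' v0 v0'.
have h1 : abs (- ((v - v') / ((w ^+ 2)%:C * (v * v')))) <= eta / 2 / c * d.
  rewrite absN; apply: (@le_trans _ _ (d / (w ^+ 2 * (c * c)))).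
    apply: abs_div_le; rewrite ?mulr_gt0 ?exprn_gt0//.
    rewrite abs_scale ?exprn_gt0// ler_wpM2l ?sqr_ge0// absM.
    by apply: ler_pM; rewrite ?(ltW c0)// ca.
  rewrite mulrC ler_wpM2r//.
  rewrite (_ : (w ^+ 2 * (c * c))^-1 = (c * w ^+ 2)^-1 / c).
    by rewrite ler_wpM2r// invr_ge0 ltW.
  by field; rewrite !gt_eqF.
have h2 : abs (((w ^+ 2 - 1) / w)%:C * (D - D')) <= eta / 2 / c * d.
  rewrite absM abs_real ger0_norm; last first.
    by rewrite divr_ge0 ?(ltW w0)// subr_ge0 expr_ge1 ?(ltW w0).
  apply: (@le_trans _ _ (w * (c * eta / 2 / (c * w) ^+ 2 * (w * d)))); last first.
    by rewrite le_eqVlt; apply/orP; left; apply/eqP; field; rewrite !gt_eqF.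
  apply: ler_pM; rewrite ?abs_ge0//.
  - by rewrite divr_ge0 ?(ltW w0)// subr_ge0 expr_ge1 ?(ltW w0).
  - by rewrite ler_pdivrMr// -expr2; lra.
  - apply: (le_trans hD); rewrite ler_wpM2r ?mulr_ge0 ?(ltW w0)//.
    by rewrite ler_wpM2r// invr_ge0 sqr_ge0.
apply: le_trans (absD _ _) _.
have -> : eta / c * d = eta / 2 / c * d + eta / 2 / c * d.
  by field; rewrite gt_eqF.
exact: lerD.
Qed.
End bulk.

Section normalization.
Context {R : realType}.
Local Open Scope complex_scope.

Lemma cintegrable_resolvent (nu : real_law R) (z : R[i]) : 0 < Im z ->
  cintegrable nu (fun x => (x%:C - z)^-1).
Proof.
move=> z0; have e x : (x%:C - z)^-1 = - 1 * (z - x%:C)^-1.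
  by rewrite -opprB invrN mulN1r.
under eq_fun do rewrite e.
apply: cintegrableZ; apply: cintegrable_dom (rintegrable_cst nu (Im z)^-1).
  exact: cmeasurable_resolvent.
by move=> x; exact: abs_resolvent_le.
Qed.

Lemma Rintegral_normalized (nu : real_law R) n (h : R -> R) :
  measurable_fun (setT : set (measurableTypeR R)) h ->
  rintegrable nu (fun x => h (x / Num.sqrt n%:R)) ->
  \int[normalized nu n]_x h x = \int[nu]_x h (x / Num.sqrt n%:R).
Proof.
move=> mh ih; rewrite /Rintegral /normalized /distribution.
rewrite (integral_pushforward (measurable_div_sqrt n))//=.
exact/measurable_EFinP.
Qed.

Lemma stieltjes_normalized (nu : real_law R) n (z : R[i]) : (0 < n)%N -> 0 < Im z ->
  stieltjes (normalized nu n) z =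
  (Num.sqrt n%:R)%:C * stieltjes nu ((Num.sqrt n%:R)%:C * z).
Proof.
move=> n0 z0; set w := Num.sqrt n%:R.
have w0 : 0 < w by rewrite sqrtr_gt0 ltr0n.
have w0' := realC_neq0 w0.
have wz : 0 < Im (w%:C * z) by rewrite Im_scale mulr_gt0.
have i1 := cintegrable_resolvent nu wz.
rewrite -[stieltjes nu _]/(cexpect nu (fun x => (x%:C - w%:C * z)^-1)).
rewrite -cexpectZ//.
have e x : (x / w)%:C - z = w%:C^-1 * (x%:C - w%:C * z).
  by rewrite rmorphM fmorphV/=; field.
have e' x : ((x / w)%:C - z)^-1 = w%:C * (x%:C - w%:C * z)^-1.
  by rewrite e invfM invrK.
have [j1 j2] := cintegrableZ w%:C i1.
have [m1 m2] : cmeasurable (fun x => (x%:C - z)^-1).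
  have [/measurable_int k1 /measurable_int k2] :=
    cintegrable_resolvent nu z0.
  by split; exact/measurable_EFinP.
apply: complex_eq => /=.
- rewrite (Rintegral_normalized m1) => [|/=].
    by apply: eq_Rintegral => x _; rewrite e'.
  by under eq_fun do rewrite e'.
- rewrite (Rintegral_normalized m2) => [|/=].
    by apply: eq_Rintegral => x _; rewrite e'.
  by under eq_fun do rewrite e'.
Qed.
End normalization.

Section continuation.
Context {R : realType}.
Context (mu : real_law R).
Local Open Scope complex_scope.
Context (mean0 : ('E_mu[id] = 0)%E).
Context (var1 : ('V_mu[id] = 1)%E).

(** The conditions on [w = sqrt n] under which [defect w] is of size [eta] at
    heights at least [c]. *)
Definition bulk_scale (c K eta w : R) : Prop :=
  [/\ 0 < w, 1 <= w, 8 <= c * w, defect_size mu K (c * w) <= c * eta / 2 &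
      (c * w ^+ 2)^-1 <= eta / 2].

Lemma bulk_scale_eventually (c K eta : R) : 0 < c -> 0 < eta ->
  \forall n \near \oo, (0 < n)%N /\ bulk_scale c K eta (Num.sqrt n%:R).
Proof.
move=> c0 eta0.
have [|Y H] := @defect_size_small R mu mean0 var1 K (c * eta / 2).
  by rewrite divr_gt0 ?mulr_gt0.
pose W := Num.max 1 (Num.max (Y / c) (2 / (c * eta))).
have W1 : 1 <= W by rewrite le_max lexx.
near=> n.
have nW : W ^+ 2 <= n%:R.
  by near: n; exact: nbhs_infty_ger.
have wW : W <= Num.sqrt n%:R.
  rewrite -[W]ger0_norm ?(le_trans _ W1)// -sqrtr_sqr ler_sqrt//.
have w0 : 0 < Num.sqrt n%:R :> R by rewrite (lt_le_trans _ wW)// (lt_le_trans _ W1).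
split; first by rewrite -(ltr0n R) -sqrtr_gt0.
have : Y <= c * Num.sqrt n%:R.
  rewrite mulrC -ler_pdivrMr//; apply: le_trans wW.
  by rewrite /W !le_max lexx orbT.
move/H => [h1 h2]; split=> //; first exact: le_trans wW.
have : 2 / (c * eta) <= Num.sqrt n%:R.
  by apply: le_trans wW; rewrite /W !le_max lexx !orbT.
move: (Num.sqrt n%:R) w0 (le_trans W1 wW) => w w0 w1 hw.
have hw2 : 2 / (c * eta) <= w ^+ 2 by rewrite (le_trans hw)// expr2 ler_peMl// ltW.
rewrite invfM ler_pdivrMr ?exprn_gt0//.
rewrite (_ : c^-1 = eta / 2 * (2 / (c * eta))); last by field; rewrite !gt_eqF.
by rewrite ler_wpM2l// divr_ge0// ltW.
Unshelve. all: by end_near.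
Qed.

(** The bound [|v| <= K c = 3 + 4/c] follows from the relation between [z] and the
    common preimage, since each of the [n - 1] terms [excess] has modulus at most
    [4 / (c w)]. *)
Lemma bulk_point (c K eta w : R) n (us : nat -> R[i]) (m z : R[i]) :
  0 < c -> K * c = 3 + 4 / c -> bulk_scale c K eta w ->
  w ^+ 2 = n%:R -> (0 < n)%N -> abs z <= 3 ->
  (forall k, (k < n)%N -> c * w <= Im (us k)) ->
  (forall k, (k < n)%N -> m = stieltjes mu (us k)) ->
  w%:C * z + n%:R * - m^-1 = - m^-1 + \sum_(k < n) us k ->
  exists v, [/\ forall k, (k < n)%N -> us k = w%:C * v, c <= Im v, abs v <= K * c,
    v + v^-1 = z + defect mu w v &
    - m^-1 = w%:C * v + excess mu (w%:C * v)].
Proof.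
move=> c0 Kc [w0 w1 y8 hd hn] wn n0 z3 cu mu_ e.
have [eq F ez] := preimages_equal mean0 var1 y8 cu mu_ e n0.
have w0' := realC_neq0 w0.
have vE : us 0%N = w%:C * (w%:C^-1 * us 0%N) by rewrite mulrA divff// mul1r.
have hle := excess_le mean0 var1 y8 (cu _ n0).
exists (w%:C^-1 * us 0%N); move: vE; set v := _^-1 * _ => vE.
have cv : c <= Im v.
  by rewrite -(ler_pM2r w0) [leRHS]mulrC -Im_scale -vE cu.
have wnC : n%:R = (w ^+ 2)%:C :> R[i] by rewrite wn rmorph_nat.
rewrite -vE; split => //.
- rewrite -(ler_pM2l w0) -abs_scale// -vE Kc.
  have -> : us 0%N = w%:C * z + (w ^+ 2 - 1)%:C * excess mu (us 0%N).
    by rewrite ez rmorphB rmorph1/= -wnC; ring.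
  apply: le_trans (absD _ _) _; rewrite abs_scale// absM abs_real.
  have w2 : 1 <= w ^+ 2 by rewrite expr_ge1 ?(ltW w0).
  rewrite ger0_norm ?subr_ge0// mulrDr lerD ?ler_pM2l//.
  apply: (@le_trans _ _ (w ^+ 2 * (4 / (c * w)))).
    by apply: ler_pM; rewrite ?abs_ge0 ?subr_ge0//; lra.
  by rewrite le_eqVlt; apply/orP; left; apply/eqP; field; rewrite !gt_eqF.
- apply: defectE => //; first by rewrite upper_neq0// (lt_le_trans c0).
  by rewrite -vE -wnC.
Qed.

End continuation.

(** * Descent to the real axis *)

Section descent.
Context {R : realType}.
Local Open Scope complex_scope.

(** The intermediate value theorem: a continuous function avoiding the interval
    between [p] and [q] stays on the side where it starts. *)
Lemma descent_of_gap (g : R -> R) (a b p q : R) : a <= b -> p < q ->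
  (forall t, a <= t -> {for t, continuous g}) -> q <= g b ->
  (forall t, a <= t <= b -> p <= g t -> q <= g t) -> q <= g a.
Proof.
move=> ab pq cg qb gap; rewrite leNgt; apply/negP => aq.
have ap : g a < p.
  by rewrite ltNge; apply/negP => /gap; rewrite lexx ab => /(_ isT); rewrite leNgt aq.
have [||t] := @IVT R g a b ((p + q) / 2) ab.
- apply: continuous_in_subspaceT => t /set_mem; rewrite /= in_itv/= => /andP[h _].
  exact: cg.
- by rewrite ge_min le_max; apply/andP; split; apply/orP; [left|right]; lra.
- by rewrite in_itv/= => tab gt; have := gap t tab; rewrite gt; lra.
Qed.

Lemma vertical_continuous (f : R[i] -> R[i]) (w x t : R) : upper_continuous f ->
  0 < w -> 0 < t -> {for t, continuous (fun s : R => Im (f (w%:C * (x +i* s))))}.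
Proof.
move=> cf w0 t0; apply/(@cvgrPdist_lt _ R^o) => e e0.
have z0 : 0 < Im (w%:C * (x +i* t)) by rewrite Im_scale mulr_gt0.
have [d d0 H] := cf _ z0 e e0.
near=> s; rewrite -ImB (le_lt_trans (Im_le_abs _))// abs_distC H//.
rewrite -mulrBr abs_scale//.
have -> : (x +i* s) - (x +i* t) = 0 +i* (s - t) by apply: complex_eq; rewrite ?ReB ?ImB/= ?subrr.
rewrite absE/= expr0n add0r sqrtr_sqr mulrC -ltr_pdivlMr//.
near: s; exists (d / w) => /=; first by rewrite divr_gt0.
by move=> s /=; rewrite distrC.
Unshelve. all: by end_near.
Qed.

Lemma bigmin_continuous (f : nat -> R -> R) (d t : R) n :
  (forall k, (k < n)%N -> {for t, continuous (f k)}) ->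
  {for t, continuous (fun s => \big[Num.min/d]_(k < n) f k s)}.
Proof.
elim: n f => [|n IH] f H.
  have -> : (fun s : R => \big[Num.min/d]_(k < 0) f k s) = cst d.
    by apply/funext => s; rewrite big_ord0.
  exact: cst_continuous.
have -> : (fun s : R => \big[Num.min/d]_(k < n.+1) f k s) =
    f 0%N \min (fun s : R => \big[Num.min/d]_(k < n) f k.+1 s).
  by apply/funext => s; rewrite big_ord_recl.
apply: (@continuous_min R R); first exact: H.
by apply: (IH (fun k => f k.+1)) => k kn; exact: H.
Qed.

Lemma bigmin_ge (f : nat -> R) (d p : R) n :
  (p <= \big[Num.min/d]_(k < n) f k) <-> p <= d /\ forall k, (k < n)%N -> p <= f k.
Proof.
split=> [h|[pd h]].
- split; first by apply: le_trans h _; exact: bigmin_le_id.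
  by move=> k kn; apply: (le_trans h); exact: (@bigmin_le _ R _ d (Ordinal kn) (fun k : 'I_n => f k)).
- by apply/bigmin_geP; split=> // k _; exact: h.
Qed.
End descent.

(** * Local semicircle law *)

Section local_law.
Context {R : realType}.
Context (mu : real_law R).
Local Open Scope complex_scope.
Context (mean0 : ('E_mu[id] = 0)%E).
Context (var1 : ('V_mu[id] = 1)%E).

(** [descent_of_gap] applied to the smallest height of the [n] preimages.  At
    [t = 1] that height is at least [w], because subordination does not decrease
    imaginary parts; the gap comes from [joukowsky_gap]. *)
Lemma preimages_large (c K eta w x t e : R) n (u : nat -> R[i] -> R[i]) (nu : real_law R) :
  0 < c -> c <= 1 / 2 -> K * c = 3 + 4 / c -> bulk_scale mu c K eta w ->
  w ^+ 2 = n%:R -> (0 < n)%N -> 0 < e -> e < 2 ->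
  36 * c ^+ 2 <= 4 - (2 - e / 2) ^+ 2 -> eta <= c -> eta <= e / 2 ->
  (forall k, (k < n)%N -> upper_continuous (u k)) ->
  (forall k z, (k < n)%N -> 0 < Im z -> Im z <= Im (u k z)) ->
  (forall k z, (k < n)%N -> 0 < Im z -> stieltjes nu z = stieltjes mu (u k z)) ->
  (forall z, 0 < Im z ->
    z + n%:R * - (stieltjes nu z)^-1 = - (stieltjes nu z)^-1 + \sum_(k < n) u k z) ->
  `|x| <= 2 - e -> 0 < t <= 1 ->
  forall k, (k < n)%N -> 2 * c * w <= Im (u k (w%:C * (x +i* t))).
Proof.
move=> c0 c1 Kc sc wn n0 e0 e2 ce ec ee cu iu su eu xe /andP[t0 t1].
have [w0 w1 y8 hd hn] := sc.
pose f k s := Im (u k (w%:C * (x +i* s))).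
have cw : 0 < c * w by rewrite mulr_gt0.
have [|_ //] := (@bigmin_ge R (f^~ t) (2 * c * w) (2 * c * w) n).1.
(* the default value of the minimum is the target level, so it never binds *)
apply: (@descent_of_gap R (fun s => \big[Num.min/(2 * c * w)]_(k < n) f k s) t 1 (c * w)) => //.
- lra.
- move=> s ts; apply: bigmin_continuous => k kn; apply: vertical_continuous => //.
    exact: cu.
  exact: lt_le_trans ts.
- apply/(@bigmin_ge R (f^~ 1)); split=> // k kn; rewrite /f.
  have z0 : 0 < Im (w%:C * (x +i* 1)) by rewrite Im_scale mulr_gt0.
  by apply: le_trans (iu _ _ kn z0); rewrite Im_scale/= mulr1; nra.
- move=> s /andP[ts s1] /(@bigmin_ge R (f^~ s))[_ h].
  have s0 := lt_le_trans t0 ts.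
  have z0 : 0 < Im (w%:C * (x +i* s)) by rewrite Im_scale mulr_gt0.
  have z3 : abs (x +i* s) <= 3.
    apply: le_trans (abs_le_ReIm _) _ => /=; rewrite (gtr0_norm s0); lra.
  have [v [uv cv vK jv Fv]] := bulk_point mean0 var1 c0 Kc sc wn n0 z3 h
    (fun k kn => su k _ kn z0) (eu _ z0).
  have dl := defect_le mean0 var1 c0 w0 w1 y8 hd hn cv vK.
  apply/(@bigmin_ge R (f^~ s)); split=> // k kn; rewrite /f uv// Im_scale.
  rewrite [leRHS]mulrC ler_pM2r//.
  apply: (joukowsky_gap c0 cv jv (r := 2 - e / 2)) => //.
  + rewrite ReD/=; apply: le_trans (ler_normD _ _) _.
    have := Re_le_abs (defect mu w v); lra.
  + rewrite ImD/=; have := Im_le_abs (defect mu w v); rewrite ler_norml; lra.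
Qed.

Definition bulk_strip (e : R) (z : R[i]) := `|Re z| <= 2 - e /\ 0 < Im z <= 1.

(** The solution of [s + 1/s = x] on the closed upper half of the unit circle; the
    boundary value of the semicircle transform at [x] is [- 1/s]. *)
Definition semicircle_root (x : R) : R[i] := (x / 2) +i* (Num.sqrt (4 - x ^+ 2) / 2).

Lemma semicircle_root_sqr (x : R) : `|x| <= 2 ->
  [/\ 0 <= Im (semicircle_root x), abs (semicircle_root x) = 1 &
   (semicircle_root x)^-1 = (x / 2) +i* - (Num.sqrt (4 - x ^+ 2) / 2)].
Proof.
move=> x2; have h : 0 <= 4 - x ^+ 2.
  by rewrite subr_ge0 -real_normK ?num_real//; have := normr_ge0 x; nra.
have n1 : (x / 2) ^+ 2 + (Num.sqrt (4 - x ^+ 2) / 2) ^+ 2 = 1.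
  by rewrite !expr_div_n sqr_sqrtr//; field.
split.
- by rewrite /= divr_ge0.
- by rewrite absE /= n1 sqrtr1.
- by apply: complex_eq; rewrite ?ReV ?ImV/= n1 divr1.
Qed.

(** [v] is the rescaled common preimage and [s] the rescaled value of [F], so that
    the transform of the normalized law at [z] is [- 1/s]. *)
Definition bulk_solution (c K w : R) (z v s : R[i]) : Prop :=
  [/\ c <= Im v, abs v <= K * c, v + v^-1 = z + defect mu w v &
      w%:C * s = w%:C * v + excess mu (w%:C * v)].

Lemma bulk_solution_exists (c K eta w e : R) n (nu : real_law R) :
  0 < c -> c <= 1 / 2 -> K * c = 3 + 4 / c ->
  w = Num.sqrt n%:R -> (0 < n)%N -> bulk_scale mu c K eta w ->
  0 < e -> e < 2 -> 36 * c ^+ 2 <= 4 - (2 - e / 2) ^+ 2 ->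
  eta <= c -> eta <= e / 2 -> is_free_power mu n nu ->
  forall z, bulk_strip e z -> exists v s, bulk_solution c K w z v s /\
    stieltjes (normalized nu n) z = - s^-1.
Proof.
move=> c0 c1 Kc wE n0 sc e0 e2 ce ec ee nuP z [zx /andP[z0 z1]].
have wn : w ^+ 2 = n%:R by rewrite wE sqr_sqrtr.
have [u [cu iu su eu]] := free_power_preimages nuP.
have [w0 _ _ _ _] := sc; have w0' := realC_neq0 w0.
have z3 : abs z <= 3.
  apply: le_trans (abs_le_ReIm _) _ => /=; rewrite (gtr0_norm z0); lra.
have wz : 0 < Im (w%:C * z) by rewrite Im_scale mulr_gt0.
have cw0 : 0 < c * w by rewrite mulr_gt0.
(* the descent gives twice this height *)
have large k : (k < n)%N -> c * w <= Im (u k (w%:C * z)).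
  move=> kn; have -> : z = Re z +i* Im z by case: (z).
  have z01 : 0 < Im z <= 1 by rewrite z0.
  have := preimages_large c0 c1 Kc sc wn n0 e0 e2 ce ec ee cu iu su eu zx z01 kn.
  by apply: le_trans; lra.
have [v [uv cv vK jv Fv]] := bulk_point mean0 var1 c0 Kc sc wn n0 z3 large
  (fun k kn => su k _ kn wz) (eu _ wz).
exists v, (v + excess mu (w%:C * v) / w%:C); split; first by split=> //; field.
rewrite stieltjes_normalized// -wE; have -> : v + excess mu (w%:C * v) / w%:C =
   - (stieltjes nu (w%:C * z))^-1 / w%:C by rewrite Fv; field.
by rewrite invfM invrN invrK invrK mulNr opprK mulrC.
Qed.

Section bulk_solution_bounds.
Context (c K eta w : R) (c0 : 0 < c) (K0 : 0 < K) (ec : eta <= c / 4).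
Context (sc : bulk_scale mu c K eta w).

Let up (v : R[i]) : c <= Im v -> c * w <= Im (w%:C * v).
Proof.
by move=> cv; have [w0 _ _ _ _] := sc; rewrite Im_scale mulrC ler_wpM2l// ltW.
Qed.

Lemma bulk_solution_close z v s : bulk_solution c K w z v s ->
  abs (s - v) <= 2 * eta.
Proof.
move=> [cv _ _ es]; have [w0 _ y8 _ hn] := sc.
have := excess_le mean0 var1 y8 (up cv).
have -> : excess mu (w%:C * v) = w%:C * (s - v) by rewrite mulrBr es; ring.
rewrite abs_scale// => h; rewrite -(ler_pM2l w0); apply: le_trans h _.
have -> : 4 / (c * w) = w * (4 * (c * w ^+ 2)^-1).
  by field; rewrite !gt_eqF.
by rewrite ler_pM2l//; lra.
Qed.

Lemma bulk_solution_ge z v s : bulk_solution c K w z v s -> c / 2 <= abs s.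
Proof.
move=> sol; have [cv _ _ _] := sol; have := bulk_solution_close sol.
have : abs v <= abs s + abs (s - v) by rewrite -{1}(subKr s v) absB.
have := le_abs_of_Im cv; have := ec; lra.
Qed.

Lemma bulk_solution_neq0 z v s : bulk_solution c K w z v s -> s != 0.
Proof.
move/bulk_solution_ge => h; apply/eqP => s0; move: h; rewrite s0 abs0.
have := c0; lra.
Qed.

Lemma bulk_solution_lip z v s z' v' s' : eta <= c / (2 * K) ->
  bulk_solution c K w z v s -> bulk_solution c K w z' v' s' ->
  abs (- s^-1 - - s'^-1) <= 12 * K / c ^+ 2 * abs (z - z').
Proof.
move=> eK sol sol'; have [w0 w1 y8 hd hn] := sc.
have [cv vK jv es] := sol; have [cv' vK' jv' es'] := sol'.
have a := bulk_solution_ge sol; have a' := bulk_solution_ge sol'.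
have s0 := bulk_solution_neq0 sol; have s0' := bulk_solution_neq0 sol'.
have v0' := upper_neq0 (lt_le_trans c0 cv').
have hD : abs (v - v') <= 2 * K * abs (z - z').
  have := joukowsky_stable c0 cv (ltW (lt_le_trans c0 cv')) v0' vK.
  rewrite jv jv'.
  have -> : z + defect mu w v - (z' + defect mu w v') =
    (z - z') + (defect mu w v - defect mu w v') by ring.
  have := defect_lip mean0 var1 c0 w0 w1 y8 hd hn cv vK cv' vK'.
  have := absD (z - z') (defect mu w v - defect mu w v').
  set D := abs (v - v'); set d := abs (z - z') => h1 h2 h3.
  have h4 : eta / c * D <= (2 * K)^-1 * D.
    by rewrite ler_wpM2r ?abs_ge0// ler_pdivrMr// mulrC.
  have : K * abs (z - z' + (defect mu w v - defect mu w v')) <=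
      K * (d + (2 * K)^-1 * D) by rewrite ler_pM2l//; lra.
  rewrite mulrDr (_ : K * ((2 * K)^-1 * D) = D / 2); last first.
    by field; rewrite gt_eqF.
  lra.
have hs : abs (s - s') <= 3 / 2 * abs (v - v').
  rewrite -(ler_pM2l w0) -abs_scale//.
  have -> : w%:C * (s - s') = w%:C * (v - v') +
      (excess mu (w%:C * v) - excess mu (w%:C * v')).
    by rewrite mulrBr es es'; ring.
  have := excess_lip mean0 var1 y8 (up cv) (up cv').
  rewrite -mulrBr abs_scale// => h5; apply: le_trans (absD _ _) _.
  by rewrite abs_scale//; lra.
have -> : - s^-1 - - s'^-1 = (s - s') / (s * s') by field; rewrite s0 s0'.
have c20 : 0 < c / 2 by rewrite divr_gt0.
apply: (@le_trans _ _ (3 / 2 * (2 * K * abs (z - z')) / (c / 2 * (c / 2)))).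
  apply: abs_div_le; [|exact: mulr_gt0|].
    by apply: le_trans hs _; rewrite ler_pM2l.
  by rewrite absM; apply: ler_pM => //; exact: ltW.
by rewrite le_eqVlt; apply/orP; left; apply/eqP; field; rewrite gt_eqF.
Qed.

Lemma bulk_solution_semicircle x t v s : `|x| <= 2 -> 0 < t ->
  bulk_solution c K w (x +i* t) v s ->
  abs (- s^-1 + (semicircle_root x)^-1) <=
    2 * (K + 2) / c * eta + 2 * K / c * t.
Proof.
move=> x2 t0 sol; have [w0 w1 y8 hd hn] := sc; have [cv vK jv es] := sol.
have a := bulk_solution_ge sol; have s0 := bulk_solution_neq0 sol.
have [r0 r1 rV] := semicircle_root_sqr x2.
have rn0 : semicircle_root x != 0.
  by apply/eqP => h; move: r1; rewrite h abs0 => /eqP; rewrite eq_sym oner_eq0.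
have := joukowsky_stable c0 cv r0 rn0 vK; rewrite jv.
have -> : (x +i* t) + defect mu w v -
    (semicircle_root x + (semicircle_root x)^-1) = (0 +i* t) + defect mu w v.
  by rewrite rV; apply: complex_eq; rewrite !(ReD, ImD, ReN, ImN)/=; field.
have := absD (0 +i* t) (defect mu w v).
have := defect_le mean0 var1 c0 w0 w1 y8 hd hn cv vK.
have -> : abs (0 +i* t) = t.
  by rewrite absE/= expr0n add0r sqrtr_sqr gtr0_norm.
move=> h1 h2 h3.
have h4 : abs (v - semicircle_root x) <= K * (t + eta).
  by apply: le_trans h3 _; rewrite ler_pM2l//; apply: le_trans h2 _; rewrite lerD2l.
have h5 : abs (s - semicircle_root x) <= 2 * eta + K * (t + eta).
  have -> : s - semicircle_root x = (s - v) + (v - semicircle_root x) by ring.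
  by apply: le_trans (absD _ _) _; rewrite lerD// (bulk_solution_close sol).
have -> : - s^-1 + (semicircle_root x)^-1 =
  (s - semicircle_root x) / (s * semicircle_root x) by field; rewrite s0 rn0.
have c20 : 0 < c / 2 by rewrite divr_gt0.
apply: (@le_trans _ _ ((2 * eta + K * (t + eta)) / (c / 2))).
  by apply: abs_div_le => //; rewrite absM r1 mulr1.
by rewrite le_eqVlt; apply/orP; left; apply/eqP; field; rewrite gt_eqF.
Qed.
End bulk_solution_bounds.

(** [L] is chosen before the accuracy [eps] and the index [n], so the boundary
    densities are equi-Lipschitz and the error [eps + L * t] can be made small by
    taking first [n] large and then [t] small. *)
Lemma local_semicircle_law (e : R) : 0 < e -> e < 2 -> exists L : R, 0 < L /\
  forall eps : R, 0 < eps -> \forall n \near \oo, forall nu, is_free_power mu n nu ->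
    (forall z z', bulk_strip e z -> bulk_strip e z' ->
      abs (stieltjes (normalized nu n) z - stieltjes (normalized nu n) z')
        <= L * abs (z - z')) /\
    (forall x t : R, `|x| <= 2 - e -> 0 < t <= 1 ->
      abs (stieltjes (normalized nu n) (x +i* t) + (semicircle_root x)^-1)
        <= eps + L * t).
Proof.
move=> e0 e2.
have [c [c0 c1 ce]] : exists c : R, [/\ 0 < c, c <= 1 / 2 &
    36 * c ^+ 2 <= 4 - (2 - e / 2) ^+ 2].
  (* with [k = 4 - (2 - e/2)^2 <= 3], [36 (k/12)^2 = k^2/4 <= k] *)
  exists ((4 - (2 - e / 2) ^+ 2) / 12).
  have : 0 < 4 - (2 - e / 2) ^+ 2 <= 3 by apply/andP; split; nra.
  by move: (4 - _) => k /andP[k0 k3]; split; nra.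
have [K [Kc K0]] : exists K : R, K * c = 3 + 4 / c /\ 0 < K.
  exists ((3 + 4 / c) / c); split; first by rewrite divfK// gt_eqF.
  by rewrite divr_gt0// addr_gt0// divr_gt0.
pose L := Num.max (12 * K / c ^+ 2) (2 * K / c).
have L0 : 0 < L.
  by rewrite lt_max; apply/orP; left; apply: divr_gt0; [apply: mulr_gt0|apply: exprn_gt0].
exists L; split=> // eps eps0.
have K40 : 0 < K + 4 by rewrite addr_gt0.
(* the four bounds serve the lower bound on [|s|], the real part in the gap
   argument, the Lipschitz estimate and the accuracy, in this order *)
pose eta := Num.min (c / 4) (Num.min (e / 2)
  (Num.min (c / (2 * K)) (eps * c / (2 * (K + 4))))).
have eta0 : 0 < eta by rewrite !lt_min !divr_gt0 ?mulr_gt0.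
have /and4P[ec ee eK eE] : [&& eta <= c / 4, eta <= e / 2, eta <= c / (2 * K) &
    eta <= eps * c / (2 * (K + 4))].
  by rewrite !ge_min !lexx !orbT.
near=> n => nu nuP.
have [n0 sc] : (0 < n)%N /\ bulk_scale mu c K eta (Num.sqrt n%:R).
  by near: n; exact: bulk_scale_eventually.
have ec1 : eta <= c by lra.
have sol := bulk_solution_exists c0 c1 Kc erefl n0 sc e0 e2 ce ec1 ee nuP.
split.
- move=> z z' /sol[v [s [vs ->]]] /sol[v' [s' [vs' ->]]].
  apply: le_trans (bulk_solution_lip c0 K0 ec sc eK vs vs') _.
  by rewrite ler_wpM2r ?abs_ge0// le_max lexx.
- move=> x t xe t01; have [t0 _] := andP t01.
  have x2 : `|x| <= 2 by lra.
  have /sol[v [s [vs ->]]] : bulk_strip e (x +i* t) by split.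
  apply: le_trans (bulk_solution_semicircle c0 K0 ec sc x2 t0 vs) _.
  apply: lerD; last by rewrite ler_pM2r// le_max lexx orbT.
  apply: (@le_trans _ _ (2 * (K + 2) / c * (eps * c / (2 * (K + 4))))).
    by rewrite ler_wpM2l// divr_ge0 ?(ltW c0)// mulr_ge0// addr_ge0// ltW.
  have -> : 2 * (K + 2) / c * (eps * c / (2 * (K + 4))) = eps * ((K + 2) / (K + 4)).
    by field; rewrite !gt_eqF.
  by rewrite ler_piMr ?(ltW eps0)// ler_pdivrMr// mul1r lerD2l ler_nat.
Unshelve. all: by end_near.
Qed.
End local_law.

(** * Stieltjes inversion for Lipschitz boundary behaviour *)

Section poisson.
Context {R : realType}.
Local Open Scope complex_scope.
Local Notation leb := (@lebesgue_measure R).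

Definition poisson (t x s : R) : R := t / ((s - x) ^+ 2 + t ^+ 2).

Lemma poisson_den_gt0 (t x s : R) : 0 < t -> 0 < (s - x) ^+ 2 + t ^+ 2.
Proof. by move=> t0; rewrite ltr_wpDl ?sqr_ge0// exprn_gt0. Qed.

Lemma poisson_ge0 t x s : 0 < t -> 0 <= poisson t x s.
Proof. by move=> t0; rewrite divr_ge0// ltW// poisson_den_gt0. Qed.

Lemma poisson_le t x s : 0 < t -> poisson t x s <= t^-1.
Proof.
move=> t0; rewrite ler_pdivrMr ?poisson_den_gt0// mulrDr.
rewrite [X in _ + X](_ : _ = t); last by field; rewrite gt_eqF.
by rewrite lerDr mulr_ge0 ?sqr_ge0// invr_ge0 ltW.
Qed.

Lemma measurable_poisson2 t : 0 < t ->
  measurable_fun (setT : set (measurableTypeR R * measurableTypeR R)%type)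
    (fun z => poisson t z.1 z.2).
Proof.
move=> t0; apply: measurable_funM; first exact: measurable_cst.
apply: measurable_inv => [z|]; first by rewrite gt_eqF// poisson_den_gt0.
apply: measurable_funD; last exact: measurable_cst.
by apply: measurable_funX; apply: measurable_funB;
  [exact: measurable_snd|exact: measurable_fst].
Qed.

Lemma measurable_poisson t x : 0 < t ->
  measurable_fun (setT : set (measurableTypeR R)) (poisson t x).
Proof.
move=> t0; apply: measurable_funM; first exact: measurable_cst.
apply: measurable_inv => [z|]; first by rewrite gt_eqF// poisson_den_gt0.
by apply: measurable_funD => //; apply: measurable_funX; apply: measurable_funB.
Qed.

Lemma rintegrable_poisson (nu : real_law R) t x : 0 < t ->
  rintegrable nu (poisson t x).
Proof.
move=> t0; apply: (@rintegrable_dom _ _ _ (fun=> t^-1)).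
- exact: measurable_poisson.
- by move=> s; rewrite ger0_norm ?poisson_ge0// poisson_le.
- exact: rintegrable_cst.
Qed.

Lemma boundary_imE (nu : real_law R) (x t : R) : 0 < t ->
  boundary_im nu x t = \int[nu]_s poisson t x s.
Proof.
move=> t0; rewrite /boundary_im /stieltjes /=; apply: eq_Rintegral => s _.
by rewrite /= sub0r sqrrN mulNr opprK.
Qed.

(** The Poisson kernel is the derivative of [atan ((x - s) / t)] in [x]. *)
Lemma integral_poisson (t a b s : R) : 0 < t -> a < b ->
  (\int[leb]_(x in `]a, b]) (poisson t x s)%:E =
   (atan ((b - s) / t) - atan ((a - s) / t))%:E)%E.
Proof.
move=> t0 ab; have t0' : t != 0 by rewrite gt_eqF.
pose F (x : R) := atan ((x - s) / t) : R^o.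
have dF (x : R) : is_derive x 1 F (poisson t x s).
  have d1 : is_derive x (1 : R) (fun x : R => (x - s) / t : R^o) (t^-1 : R).
    apply: is_derive_eq; rewrite !scaler0 !(addr0, add0r, subr0, oppr0) /=.
    by rewrite /GRing.scale /= mulr1.
  apply: (is_derive_eq (is_derive1_comp (is_derive1_atan _) d1)).
  rewrite /poisson /GRing.scale /=; field.
  by rewrite t0' andbT gt_eqF// poisson_den_gt0.
rewrite integral_itv_obnd_cbnd; last first.
  apply/measurable_EFinP; apply: measurable_funTS.
  have := @measurable_poisson t s t0; congr (measurable_fun _ _).
  by apply/funext => x; rewrite /poisson -sqrrN opprB.
rewrite (@continuous_FTC2 R (poisson t ^~ s) F a b ab) -?EFinB//.
- apply: continuous_in_subspaceT => x _.
  apply: cvgM; first exact: cvg_cst.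
  apply: cvgV; first by rewrite gt_eqF// poisson_den_gt0.
  apply: cvgD; last exact: cvg_cst.
  apply: (@cvg_comp _ _ _ (fun x : R => s - x) (fun y : R => y ^+ 2)); last exact: exprn_continuous.
  by apply: cvgB; [exact: cvg_cst|exact: cvg_id].
- have cF x : F @ x --> F x.
    by apply: differentiable_continuous; apply/derivable1_diffP; case: (dF x).
  split=> [x _||]; first by case: (dF x).
  + by apply: cvg_at_right_filter; exact: cF.
  + by apply: cvg_at_left_filter; exact: cF.
- by move=> x _; rewrite derive1E; exact: derive_val.
Qed.
End poisson.

Section boundary_values.
Context {R : realType}.
Local Open Scope complex_scope.
Local Notation leb := (@lebesgue_measure R).
Implicit Types (nu : real_law R) (x t r L : R).

Definition boundary_lipschitz nu r L := [/\ 0 <= r, 0 <= L &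
  forall x x' t t', `|x| <= r -> `|x'| <= r -> 0 < t <= 1 -> 0 < t' <= 1 ->
    `|boundary_im nu x t - boundary_im nu x' t'| <= L * (`|x - x'| + `|t - t'|)].

Definition boundary_value nu x := lim (boundary_im nu x t @[t --> 0^'+]).

(** The Lipschitz bound makes the values along a vertical line a Cauchy family. *)
Lemma boundary_cvg nu r L x : boundary_lipschitz nu r L -> `|x| <= r ->
  cvg (boundary_im nu x t @[t --> 0^'+]).
Proof.
move=> [r0 L0 H] xr; apply/cauchy_cvgP/cauchy_exP => e e0.
pose t0 := Num.min 1 (e / (2 * (L + 1))).
have t00 : 0 < t0 by rewrite lt_min ltr01/= divr_gt0// mulr_gt0//; lra.
have t01 : t0 <= 1 by rewrite ge_min lexx.
have t0e : L * t0 < e.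
  have : t0 <= e / (2 * (L + 1)) by rewrite ge_min lexx orbT.
  by rewrite ler_pdivlMr; nra.
exists (boundary_im nu x t0).
suff : \forall t \near (0^'+ : set_system R),
    ball (boundary_im nu x t0) e (boundary_im nu x t) by [].
near=> t; rewrite /ball /=.
have tp : 0 < t by near: t; exact: nbhs_right_gt.
have tt : t < t0 by near: t; exact: nbhs_right_lt.
apply: le_lt_trans t0e.
have := H x x t0 t xr xr; rewrite t00 t01 tp (le_trans (ltW tt) t01) => /(_ isT isT).
move/le_trans; apply; rewrite subrr normr0 add0r ler_wpM2l// ger0_norm; lra.
Unshelve. all: by end_near.
Qed.

Lemma boundary_value_dist nu r L x t : boundary_lipschitz nu r L -> `|x| <= r ->
  0 < t <= 1 -> `|boundary_im nu x t - boundary_value nu x| <= L * t.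
Proof.
move=> lip xr /andP[t0 t1]; have [r0 L0 H] := lip.
apply/ler_addgt0Pr => e e0.
have /cvgrPdist_lt/(_ e e0) h := boundary_cvg lip xr.
near (0 : R)^'+ => s.
have sp : 0 < s by near: s; exact: nbhs_right_gt.
have st : s < t by near: s; exact: nbhs_right_lt.
have hs : `|boundary_value nu x - boundary_im nu x s| < e by near: s; exact: h.
have := H x x t s xr xr; rewrite t0 t1 sp (le_trans (ltW st) t1) => /(_ isT isT).
rewrite subrr normr0 add0r.
have : `|t - s| <= t by rewrite ger0_norm; lra.
move/(ler_wpM2l L0) => h1 h2.
rewrite -(subrKA (boundary_im nu x s)); apply: le_trans (ler_normD _ _) _.
by rewrite distrC in hs; lra.
Unshelve. all: by end_near.
Qed.

Lemma boundary_im_ge0 nu x t : 0 < t -> 0 <= boundary_im nu x t.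
Proof.
by move=> t0; rewrite boundary_imE//; apply: Rintegral_ge0 => s _; exact: poisson_ge0.
Qed.

Lemma boundary_value_ge0 nu r L x : boundary_lipschitz nu r L -> `|x| <= r ->
  0 <= boundary_value nu x.
Proof.
move=> lip xr; apply: (limr_ge (boundary_cvg lip xr)).
by near=> t; apply: boundary_im_ge0; near: t; exact: nbhs_right_gt.
Unshelve. all: by end_near.
Qed.

Lemma boundary_im_bounded nu r L x t : boundary_lipschitz nu r L -> `|x| <= r ->
  0 < t <= 1 -> `|boundary_im nu x t| <= `|boundary_im nu 0 1| + L * (r + 1).
Proof.
move=> [r0 L0 H] xr /andP[t0 t1].
have := H x 0 t 1 xr; rewrite normr0 t0 t1 ltr01 lexx => /(_ r0 isT isT).
rewrite subr0 => h.
have : `|x| + `|t - 1| <= r + 1 by apply: lerD => //; rewrite distrC ger0_norm; lra.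
move/(ler_wpM2l L0) => h2.
have : `|boundary_im nu x t| <= `|boundary_im nu 0 1| + `|boundary_im nu x t - boundary_im nu 0 1|.
  by rewrite addrC; apply: le_trans (ler_normD _ _); rewrite subrK.
lra.
Qed.

(** An atom at [a] would make the boundary values at height [t] above [a] grow like
    its mass divided by [t]. *)
Lemma boundary_no_atom nu r L a : boundary_lipschitz nu r L -> `|a| <= r ->
  nu [set a] = 0%E.
Proof.
move=> lip ar; have [r0 L0 _] := lip.
pose C := `|boundary_im nu 0 1| + L * (r + 1).
have mfin : nu [set a] \is a fin_num by exact: fin_num_measure.
rewrite -(fineK mfin); congr EFin; apply/eqP; rewrite eq_le fine_ge0 ?andbT//.
have C0 : 0 <= C by rewrite addr_ge0// mulr_ge0//; lra.
have bd t : 0 < t <= 1 -> fine (nu [set a]) <= C * t.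
  move=> /andP[t0 t1].
  have ii : rintegrable nu (fun s => t^-1 * \1_[set a] s).
    apply: rintegrableZ; apply: (@rintegrable_dom _ _ _ (fun=> 1)).
    - exact: measurable_indic.
    - by move=> s; rewrite indicE; case: (_ \in _); rewrite ?normr1 ?normr0.
    - exact: rintegrable_cst.
  have : t^-1 * fine (nu [set a]) <= boundary_im nu a t.
    rewrite boundary_imE//.
    have <- : \int[nu]_s (t^-1 * \1_[set a] s) = t^-1 * fine (nu [set a]).
      rewrite RintegralZl//; last first.
        apply: (@rintegrable_dom _ _ _ (fun=> 1)).
        - exact: measurable_indic.
        - by move=> s; rewrite indicE; case: (_ \in _); rewrite ?normr1 ?normr0.
        - exact: rintegrable_cst.
      by rewrite /Rintegral integral_indic// setIT.
    apply: le_Rintegral => //; first exact: rintegrable_poisson.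
    move=> s _; rewrite indicE; have [/set_mem ->|_] := boolP (s \in [set a]).
      by rewrite /poisson subrr expr0n add0r mulr1 expr2 invfM mulrA divff ?mul1r// gt_eqF.
    by rewrite mulr0 poisson_ge0.
  have := boundary_im_bounded lip ar (t := t); rewrite t0 t1 => /(_ isT).
  move=> /(le_trans (ler_norm _)) h1 /le_trans/(_ h1).
  by rewrite mulrC ler_pdivrMr.
rewrite leNgt; apply/negP => f0; set q := fine _ in f0 bd.
have := bd (Num.min 1 (q / (2 * (C + 1)))).
rewrite lt_min ltr01 ge_min lexx divr_gt0 ?mulr_gt0//; last lra.
move=> /(_ isT); set m := Num.min _ _ => h.
have : m <= q / (2 * (C + 1)) by rewrite ge_min lexx orbT.
rewrite ler_pdivlMr; last by lra.
have : 0 < m by rewrite lt_min ltr01 divr_gt0//; lra.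
nra.
Qed.
End boundary_values.

Section inversion.
Context {R : realType}.
Local Open Scope complex_scope.
Local Notation leb := (@lebesgue_measure R).
Implicit Types (nu : real_law R) (x t r L a b : R).

Lemma Rintegral_EFin nu (h : R -> R) : rintegrable nu h ->
  (\int[nu]_s (h s)%:E = (\int[nu]_s h s)%:E)%E.
Proof. by move=> ih; rewrite /Rintegral fineK//; exact: integrable_fin_num. Qed.

Lemma measurable_boundary_im nu t : 0 < t ->
  measurable_fun (setT : set (measurableTypeR R)) (fun x => boundary_im nu x t).
Proof.
move=> t0; apply/measurable_EFinP.
have -> : EFin \o (fun x : measurableTypeR R => boundary_im nu x t) =
    fun x => (\int[nu]_s (poisson t x s)%:E)%E.
  apply/funext => x /=; rewrite boundary_imE// Rintegral_EFin//.
  exact: rintegrable_poisson.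
apply: (@measurable_fun_fubini_tonelli_F _ _ _ _ _ nu (fun z => (poisson t z.1 z.2)%:E)).
  by apply/measurable_EFinP; exact: measurable_poisson2.
by move=> z; rewrite lee_fin poisson_ge0.
Qed.

Lemma integral_boundary_im nu t a b : 0 < t -> a < b ->
  (\int[leb]_(x in `]a, b]) (boundary_im nu x t)%:E =
   \int[nu]_s (atan ((b - s) / t) - atan ((a - s) / t))%:E)%E.
Proof.
move=> t0 ab.
pose F (z : measurableTypeR R * measurableTypeR R) :=
  (poisson t z.1 z.2 * \1_(`]a, b]%classic) z.1)%:E.
have F0 z : (0 <= F z)%E.
  by rewrite lee_fin mulr_ge0 ?poisson_ge0// indicE; case: (_ \in _).
have mF : measurable_fun setT F.
  apply/measurable_EFinP; apply: measurable_funM; first exact: measurable_poisson2.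
  by apply: measurableT_comp => //; exact: measurable_indic.
have := @fubini_tonelli _ _ _ _ R leb nu F mF F0.
have -> : (\int[leb]_x \int[nu]_y F (x, y) =
    \int[leb]_(x in `]a, b]) (boundary_im nu x t)%:E)%E.
  rewrite [RHS]integral_mkcond; apply: eq_integral => x _.
  rewrite patchE /F /= indicE; case: ifPn => xab.
    under eq_integral do rewrite mulr1.
    by rewrite Rintegral_EFin ?boundary_imE//; exact: rintegrable_poisson.
  by under eq_integral do rewrite mulr0; rewrite integral0.
move=> ->; apply: eq_integral => s _.
rewrite -integral_poisson// [RHS]integral_mkcond; apply: eq_integral => x _.
by rewrite patchE /F /= indicE; case: ifPn => xab; rewrite ?mulr1 ?mulr0.
Qed.

Lemma harmonic_itv n : 0 < (n.+1%:R^-1 : R) <= 1.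
Proof. by rewrite invr_gt0 ltr0n/= invf_le1// ler1n. Qed.

Lemma boundary_value_cvg_harmonic nu r L x : boundary_lipschitz nu r L -> `|x| <= r ->
  (boundary_im nu x n.+1%:R^-1)%:E @[n --> \oo] --> (boundary_value nu x)%:E.
Proof.
move=> lip xr; have [_ L0 _] := lip.
apply: cvg_EFin; first by near=> n.
apply/cvgrPdist_lt => e e0.
have : (L * n.+1%:R^-1 @[n --> \oo] --> L * 0)%R.
  by apply: cvgM; [exact: cvg_cst|exact: cvg_harmonic].
rewrite mulr0 => /cvgrPdist_lt/(_ e e0) h; near=> n.
rewrite distrC; apply: (le_lt_trans (boundary_value_dist lip xr (harmonic_itv n))).
have : `|0 - L * n.+1%:R^-1| < e by near: n; exact: h.
by rewrite sub0r normrN ger0_norm// mulr_ge0// ltW.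
Unshelve. all: by end_near.
Qed.

Lemma measurable_boundary_value nu r L (D : set (measurableTypeR R)) :
  boundary_lipschitz nu r L -> measurable D -> (forall x, D x -> `|x| <= r) ->
  measurable_fun D (fun x => (boundary_value nu x)%:E).
Proof.
move=> lip mD Dr.
apply: (@emeasurable_fun_cvg _ _ _ _
  (fun n (x : measurableTypeR R) => (boundary_im nu x n.+1%:R^-1)%:E)) => [n|x Dx].
  by apply/measurable_EFinP/measurable_funTS; exact: measurable_boundary_im.
exact: boundary_value_cvg_harmonic lip (Dr x Dx).
Qed.

Lemma atan_scaled_cvg (c : R) : 0 < c ->
  atan (c / n.+1%:R^-1) @[n --> \oo] --> (pi / 2 : R).
Proof.
move=> c0; apply: (@cvg_comp _ _ _ (fun n : nat => c / n.+1%:R^-1) atan); last exact: cvgy_atan.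
apply/cvgryPge => A; near=> n; rewrite invrK mulrC -ler_pdivrMr//.
apply: (@le_trans _ _ n%:R); last by rewrite ler_nat.
by near: n; exact: nbhs_infty_ger.
Unshelve. all: by end_near.
Qed.

Lemma atan_scaledN_cvg (c : R) : c < 0 ->
  atan (c / n.+1%:R^-1) @[n --> \oo] --> (- (pi / 2) : R).
Proof.
move=> c0; have -> : (fun n : nat => atan (c / n.+1%:R^-1)) =
    (fun n : nat => - atan (- c / n.+1%:R^-1)).
  by apply/funext => n; rewrite mulNr atanN opprK.
by apply: cvgN; apply: atan_scaled_cvg; rewrite oppr_gt0.
Qed.

Lemma atan_bound (y : R) : `|atan y| <= pi / 2.
Proof. by rewrite ler_norml (ltW (atan_gtNpi2 _)) (ltW (atan_ltpi2 _)). Qed.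

(** Both sides are limits of the double integral of the Poisson kernel at height
    [1/(n+1)] against Lebesgue measure on the interval and [nu].  Integrating
    first against [nu] gives the bounded functions [boundary_im], which converge;
    integrating first in space gives arctangent differences, which are bounded by
    [pi] and converge to [pi] inside the interval and to 0 outside, the two end
    points being negligible since they carry no mass. *)
Lemma boundary_value_interval nu r L a b : boundary_lipschitz nu r L ->
  - r <= a -> a < b -> b <= r ->
  (\int[leb]_(x in `]a, b]) (boundary_value nu x)%:E = pi%:E * nu `]a, b]%classic)%E.
Proof.
move=> lip ra ab br; have [r0 L0 _] := lip.
pose tn (n : nat) : R := n.+1%:R^-1.
have tn01 n : 0 < tn n <= 1 := harmonic_itv n.
have tn0 n : 0 < tn n by case/andP: (tn01 n).
have mab : measurable (`]a, b]%classic : set (measurableTypeR R)) by [].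
have inr x : `]a, b]%classic x -> `|x| <= r.
  by rewrite /= in_itv/= ler_norml => /andP[h1 h2]; lra.
pose f (n : nat) (x : measurableTypeR R) := (boundary_im nu x (tn n))%:E.
have mf n : measurable_fun (`]a, b]%classic : set (measurableTypeR R)) (f n).
  by apply/measurable_EFinP/measurable_funTS; exact: measurable_boundary_im.
have cf x : `]a, b]%classic x -> f n x @[n --> \oo] --> (boundary_value nu x)%:E.
  by move=> /inr xr; exact: boundary_value_cvg_harmonic lip xr.
pose C := `|boundary_im nu 0 1| + L * (r + 1).
have iC : leb.-integrable `]a, b]%classic (EFin \o cst C).
  apply/integrableP; split; first exact/measurable_EFinP/measurable_cst.
  under eq_integral do rewrite /=.
  rewrite integral_cst//= lebesgue_measure_itv/= lte_fin ab -EFinB -EFinM.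
  exact: ltry.
have mbv : measurable_fun (`]a, b]%classic : set (measurableTypeR R))
    (fun x => (boundary_value nu x)%:E).
  exact: measurable_boundary_value lip mab inr.
have [|| _ _ lhs] := @dominated_convergence _ _ _ leb _ mab f
  (fun x => (boundary_value nu x)%:E) (EFin \o cst C) mf mbv _ iC _.
- by apply: aeW => x xab; exact: cf.
- apply: aeW => x n xab; rewrite /f /= lee_fin.
  exact: boundary_im_bounded lip (inr _ xab) (tn01 n).
pose g (n : nat) (s : measurableTypeR R) :=
  (atan ((b - s) / tn n) - atan ((a - s) / tn n))%:E.
pose G (s : measurableTypeR R) := ((pi : R) * \1_(`]a, b]%classic) s)%:E.
have mat (c t : R) : measurable_fun (setT : set (measurableTypeR R))
    (fun s : R => atan ((c - s) / t)).
  apply: measurableT_comp.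
    by apply: continuous_measurable_fun => x; exact: continuous_atan.
  by apply: measurable_funM => //; exact: measurable_funB.
have mg n : measurable_fun setT (g n).
  by apply/measurable_EFinP; apply: measurable_funB; exact: mat.
have mG : measurable_fun setT G.
  by apply/measurable_EFinP; apply: measurable_funM => //; exact: measurable_indic.
have ip : nu.-integrable setT (EFin \o cst (pi : R)).
  exact: (rintegrable_cst nu (pi : R)).
have atoms : nu [set a; b] = 0%E.
  apply/eqP; rewrite eq_le measure_ge0 andbT.
  apply: le_trans (measureU2 _ _ _) _ => //.
  have ha : `|a| <= r by rewrite ler_norml; lra.
  have hb : `|b| <= r by rewrite ler_norml; lra.
  have /= -> := boundary_no_atom lip ha; have /= -> := boundary_no_atom lip hb.
  by rewrite adde0.
have [|| _ _ rhs] := @dominated_convergence _ _ _ nu setT measurableT g G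
  (EFin \o cst (pi : R)) mg mG _ ip _.
- exists [set a; b]; split => //; first exact: measurableU.
  move=> s /= ns; apply: contrapT => nab; apply: ns => _.
  have {nab} [na nb] : s != a /\ s != b.
    by split; apply/eqP => h; apply: nab; [left|right].
  apply: cvg_EFin; first by near=> n.
  rewrite indicE; have [sa|sa|sa] := ltgtP s a; last by rewrite sa eqxx in na.
  + have sb : s < b by lra.
    have -> : (s \in `]a, b]%classic) = false.
      by apply/negbTE; rewrite notin_setE/= in_itv/=; move=> /andP[h _]; lra.
    rewrite mulr0 -(subrr (pi / 2)).
    by apply: cvgB; apply: atan_scaled_cvg; lra.
  + have [sb|sb|sb] := ltgtP s b; last by rewrite sb eqxx in nb.
    * have -> : s \in `]a, b]%classic by rewrite inE/= in_itv/= sa ltW.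
      have -> : pi * true%:R = pi / 2 - (- (pi / 2)) :> R by rewrite mulr1; field.
      by apply: cvgB; [apply: atan_scaled_cvg|apply: atan_scaledN_cvg]; lra.
    * have -> : (s \in `]a, b]%classic) = false.
        by apply/negbTE; rewrite notin_setE/= in_itv/= => /andP[_ h]; lra.
      rewrite mulr0 -(subrr (- (pi / 2))).
      by apply: cvgB; apply: atan_scaledN_cvg; lra.
- apply: aeW => s n _; rewrite /g /= lee_fin.
  apply: le_trans (ler_normB _ _) _.
  by rewrite (_ : pi = pi / 2 + pi / 2); [apply: lerD; exact: atan_bound|field].
have E n : (\int[leb]_(x in `]a, b]) f n x = \int[nu]_s g n s)%E.
  exact: integral_boundary_im.
have -> : (pi%:E * nu `]a, b]%classic = \int[nu]_s G s)%E.
  rewrite /G; under eq_integral do rewrite EFinM.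
  rewrite ge0_integralZl//; last 2 first.
  - by apply/measurable_EFinP; exact: measurable_indic.
  - by rewrite lee_fin pi_ge0.
  by rewrite integral_indic// setIT.
have EE : (fun n => \int[leb]_(x in `]a, b]) f n x)%E = (fun n => \int[nu]_s g n s)%E.
  by apply/funext.
apply: (cvg_unique (@ereal_hausdorff R) _ rhs).
by rewrite -EE.
Unshelve. all: by end_near.
Qed.

End inversion.

Section weighted_lebesgue.
Context {R : realType}.
Context (h : R -> R) (h0 : forall x, 0 <= h x).
Context (mh : measurable_fun (setT : set (measurableTypeR R)) h).
Local Notation leb := (@lebesgue_measure R).

(** The proofs of nonnegativity and measurability are arguments so that the measure
    structure can be inferred from the term. *)
Definition weighted_lebesgue of (forall x, 0 <= h x) &
    measurable_fun (setT : set (measurableTypeR R)) h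
  : set (measurableTypeR R) -> \bar R :=
  fun A => (\int[leb]_(x in A) (h x)%:E)%E.

Let m := weighted_lebesgue h0 mh.

Let m0 : m set0 = 0%E. Proof. exact: integral_set0. Qed.

Let m_ge0 A : (0 <= m A)%E.
Proof. by apply: integral_ge0 => x _; rewrite lee_fin. Qed.

Let m_sigma_additive : semi_sigma_additive m.
Proof.
move=> /= F mF tF mUF; rewrite /m /weighted_lebesgue; apply: cvg_toP.
  apply: ereal_nondecreasing_is_cvgn => i j ij.
  apply: lee_sum_nneg_natr => // k _ _.
  by apply: integral_ge0 => x _; rewrite lee_fin.
rewrite ge0_integral_bigcup//=.
  by apply/measurable_EFinP; exact: measurable_funTS.
by move=> x _; rewrite lee_fin.
Qed.

HB.instance Definition _ := isMeasure.Build _ _ _ (weighted_lebesgue h0 mh)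
  m0 m_ge0 m_sigma_additive.
End weighted_lebesgue.

Section density.
Context {R : realType}.
Local Notation leb := (@lebesgue_measure R).
Implicit Types (nu : real_law R) (x t r L a b : R).

Lemma half_open_itvI (a b c d : R) :
  `]a, b]%classic `&` `]c, d]%classic = `]Num.max a c, Num.min b d]%classic.
Proof.
apply/seteqP; split=> x /=; rewrite !in_itv/= gt_max le_min.
  by move=> [/andP[-> ->] /andP[-> ->]].
by move=> /andP[/andP[-> ->] /andP[-> ->]].
Qed.

Lemma measurable_density nu r L (D : set (measurableTypeR R)) :
  boundary_lipschitz nu r L -> measurable D -> (forall x, D x -> `|x| <= r) ->
  measurable_fun D (fun x => (density nu x)%:E).
Proof.
move=> lip mD Dr; apply/measurable_EFinP/measurable_funM.
  exact: measurable_cst.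
by have /measurable_EFinP := measurable_boundary_value lip mD Dr.
Qed.

(** Both sides are finite measures of [A] once the density is cut off outside the
    half-open interval; they agree on half-open intervals, which generate the
    Borel sets and are stable under intersection. *)
Lemma density_formula nu r L (A : set (measurableTypeR R)) :
  boundary_lipschitz nu r L -> measurable A -> A `<=` `]- r, r]%classic ->
  nu A = (\int[leb]_(x in A) (density nu x)%:E)%E.
Proof.
move=> lip mA Ar.
pose J : set (measurableTypeR R) := `]- r, r]%classic.
have mJ : measurable J by exact: measurable_itv.
have Jr x : J x -> `|x| <= r.
  by rewrite /J /= in_itv/= ler_norml => /andP[h1 h2]; rewrite (ltW h1).
have dE x : density nu x = pi^-1 * boundary_value nu x by [].
(* cut off to have a nonnegative measurable function on the whole line *)
pose h := (density nu : measurableTypeR R -> R) \_ J.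
have h0 x : 0 <= h x.
  rewrite /h patchE; case: ifPn => // /set_mem xJ.
  by rewrite dE mulr_ge0 ?invr_ge0 ?pi_ge0//; exact: boundary_value_ge0 lip (Jr x xJ).
have mh : measurable_fun setT h.
  apply/(measurable_restrictT _ mJ).
  by have /measurable_EFinP := measurable_density lip mJ Jr.
have agree X : ocitv X -> mrestr nu mJ X = weighted_lebesgue h0 mh X.
  move=> [[a b] _ <-] /=; rewrite /mrestr /weighted_lebesgue.
  have -> : (\int[leb]_(x in `]a, b]) (h x)%:E =
      \int[leb]_(x in `]a, b] `&` J) (density nu x)%:E)%E.
    rewrite integral_mkcondr; apply: eq_integral => x _.
    by rewrite /h !patchE; case: ifPn.
  rewrite /J half_open_itvI; set a' := Num.max _ _; set b' := Num.min _ _.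
  have [ab|ba] := ltP a' b'; last first.
    rewrite set_itv_ge ?bnd_simp -?leNgt//.
    by rewrite measure0 integral_set0.
  have ra : - r <= a' by rewrite le_max lexx orbT.
  have br : b' <= r by rewrite ge_min lexx orbT.
  have E := boundary_value_interval lip ra ab br.
  under eq_integral do rewrite dE EFinM.
  rewrite ge0_integralZl//=; last 3 first.
  - apply: (measurable_boundary_value lip) => // x; rewrite /= in_itv/= ler_norml.
    by move=> /andP[h1 h2]; rewrite (ltW (le_lt_trans ra h1)) (le_trans h2 br).
  - move=> x; rewrite /= in_itv/= => /andP[h1 h2]; rewrite lee_fin.
    apply: (boundary_value_ge0 lip); rewrite ler_norml.
    by rewrite (ltW (le_lt_trans ra h1)) (le_trans h2 br).
  - by rewrite lee_fin invr_ge0 pi_ge0.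
  by rewrite E muleA -EFinM mulVf ?mul1e// gt_eqF// pi_gt0.
have E : mrestr nu mJ A = weighted_lebesgue h0 mh A.
  apply: (@measure_unique _ R (measurableTypeR R) (@ocitv R)
    (fun k : nat => `](- k%:R), k%:R]%classic)) => //.
  - exact: ocitvI.
  - by move=> k; exact: is_ocitv.
  - apply/seteqP; split=> // x _; exists (Num.truncn `|x|).+1 => //=.
    have := truncnS_gt `|x|; rewrite in_itv/= ltr_norml => /andP[h1 h2].
    by rewrite h1 ltW.
  - move=> k; apply: le_lt_trans (probability_le1 nu _) (ltry 1).
    exact: measurableI.
move: E; rewrite /mrestr setIidl// => ->.
rewrite /weighted_lebesgue; apply: eq_integral => x /set_mem xA.
by rewrite /h patchE mem_set//; exact: Ar.
Qed.
End density.

(** * Convergence of the densities in the bulk *)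

Section bulk_density.
Context {R : realType}.
Local Open Scope complex_scope.
Implicit Types (nu : real_law R) (x t r L : R).

Lemma boundary_lipschitz_of_stieltjes nu r L : 0 <= r -> 0 <= L ->
  (forall z z', `|Re z| <= r /\ 0 < Im z <= 1 -> `|Re z'| <= r /\ 0 < Im z' <= 1 ->
    abs (stieltjes nu z - stieltjes nu z') <= L * abs (z - z')) ->
  boundary_lipschitz nu r L.
Proof.
move=> r0 L0 H; split=> // x x' t t' xr xr' tt tt'.
rewrite /boundary_im -ImB; apply: (le_trans (Im_le_abs _)).
apply: (le_trans (H (x +i* t) (x' +i* t') _ _)) => //.
by rewrite ler_wpM2l// (le_trans (abs_le_ReIm _))// ReB ImB.
Qed.

(** Compare at height [t] and let [t] tend to 0. *)
Lemma density_near_semicircle nu r L x (e : R) : boundary_lipschitz nu r L ->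
  `|x| <= r -> r <= 2 ->
  (forall t, 0 < t <= 1 ->
    abs (stieltjes nu (x +i* t) + (semicircle_root x)^-1) <= e + L * t) ->
  `|semicircle_density x - density nu x| <= e.
Proof.
move=> lip xr r2 H; have [r0 L0 _] := lip.
have x2 : `|x| <= 2 by lra.
have [_ _ rV] := semicircle_root_sqr x2.
have h4 : 0 <= 4 - x ^+ 2.
  by rewrite subr_ge0 -real_normK ?num_real//; have := normr_ge0 x; nra.
have -> : semicircle_density x = pi^-1 * (Num.sqrt (4 - x ^+ 2) / 2).
  by rewrite /semicircle_density max_l// invfM; ring.
rewrite -[density nu x]/(pi^-1 * boundary_value nu x) -mulrBr normrM.
have p1 : `|pi^-1 : R| <= 1.
  by rewrite ger0_norm ?invr_ge0 ?pi_ge0// invf_le1 ?pi_gt0//; have := pi_ge2 R; lra.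
apply: le_trans (ler_piMl (normr_ge0 _) p1) _.
set q := Num.sqrt _ / 2.
have B t : 0 < t <= 1 -> `|q - boundary_value nu x| <= e + 2 * (L * t).
  move=> t01; have h1 := boundary_value_dist lip xr t01.
  have h2 := le_trans (Im_le_abs _) (H t t01).
  rewrite rV ImD /= -/(boundary_im nu x t) distrC in h2.
  rewrite -(subrKA (boundary_im nu x t)); apply: le_trans (ler_normD _ _) _.
  lra.
apply/ler_addgt0Pr => d d0.
pose t := Num.min 1 (d / (2 * L + 1)).
have t0 : 0 < t by rewrite lt_min ltr01 divr_gt0//; lra.
have t1 : t <= 1 by rewrite ge_min lexx.
have td : t <= d / (2 * L + 1) by rewrite ge_min lexx orbT.
have := B t; rewrite t0 t1 => /(_ isT) /le_trans; apply.
by move: td; rewrite ler_pdivlMr; nra.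
Qed.

Lemma uniform_cvg_dist (A : set R) (f : nat -> R -> R) (g : R -> R) :
  (forall e : R, 0 < e -> \forall n \near \oo, forall x, A x -> `|g x - f n x| <= e) ->
  {uniform A, f @ \oo --> g}.
Proof.
move=> H P /uniform_nbhs[E [+ EP]]; rewrite -entourage_ballE => -[e /= e0 eE].
have e20 : 0 < e / 2 by rewrite divr_gt0.
have := H (e / 2) e20; apply: filterS => n hn; apply: EP => x Ax /=; apply: eE.
by rewrite /ball /=; apply: le_lt_trans (hn x Ax) _; lra.
Qed.
End bulk_density.

Unset Implicit Arguments.

Theorem theorem4p1 (R : realType) (mu : real_law R)
    (mu_mean0 : ('E_mu[id] = 0)%E) (mu_var1 : ('V_mu[id] = 1)%E)
    (mu_power : nat -> real_law R)
    (mu_powerP : forall n : nat, (1 <= n)%N -> is_free_power mu n (mu_power n))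
    (eps : R) (eps_gt0 : 0 < eps) :
  let mu_ (n : nat) := normalized (mu_power n) n in
  let I := `[- 2 + eps, 2 - eps]%R in
  (\forall n \near \oo,
    [/\ mrestr (mu_ n) (measurable_itv I) `<< @lebesgue_measure R,
        (forall x : R, x \in I ->
          cvg (boundary_im (mu_ n) x eta @[eta --> 0^'+])) &
        (forall A : set (measurableTypeR R), measurable A -> A `<=` [set` I] ->
          mu_ n A = \int[lebesgue_measure]_(x in A) (density (mu_ n) x)%:E)%E])
  /\ {uniform [set` I], (fun n => density (mu_ n)) @ \oo --> semicircle_density}.
Proof.
move=> mu_ I.
(* half of [eps] leaves room for the given segment inside a half-open interval
   on which the inversion formula holds; the minimum handles large [eps] *)
pose e := Num.min (eps / 2) 1.
have e0 : 0 < e by rewrite lt_min ltr01 divr_gt0.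
have e1 : e <= 1 by rewrite ge_min lexx orbT.
have eeps : e <= eps / 2 by rewrite ge_min lexx.
have e2 : e < 2 by lra.
have r0 : 0 <= 2 - e by lra.
have [L [L0 law]] := local_semicircle_law mu_mean0 mu_var1 e0 e2.
have Ir x : x \in I -> `|x| <= 2 - e.
  by rewrite /I in_itv/= ler_norml => /andP[h1 h2]; lra.
have lip : \forall n \near \oo, boundary_lipschitz (mu_ n) (2 - e) L.
  have := law 1 ltr01; apply: filterS2 (nbhs_infty_ge 1) => n n1.
  move=> /(_ _ (mu_powerP n n1))[H _].
  exact: (boundary_lipschitz_of_stieltjes r0 (ltW L0)).
split.
- apply: filterS lip => n lip.
  have Idens (A : set (measurableTypeR R)) : measurable A -> A `<=` [set` I] ->
      mu_ n A = (\int[lebesgue_measure]_(x in A) (density (mu_ n) x)%:E)%E.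
    move=> mA AI; apply: (density_formula lip mA) => x /AI.
    by rewrite /= /I !in_itv/= => /andP[h1 h2]; apply/andP; split; lra.
  split=> //; last by move=> x /Ir; exact: boundary_cvg lip.
  apply/null_content_dominatesP => A mA A0.
  have mI : measurable ([set` I] : set (measurableTypeR R)) by exact: measurable_itv.
  rewrite /mrestr Idens//; last exact: measurableI.
  have AI : A `&` [set` I] `<=` [set` I] by move=> x [].
  apply: null_set_integral; first exact: measurableI.
    apply: (measurable_density lip); first exact: measurableI.
    by move=> x /AI /Ir.
  apply/eqP; rewrite eq_le measure_ge0 andbT -A0.
  by apply: le_measure; rewrite ?inE//; exact: measurableI.
- apply: uniform_cvg_dist => d d0.
  have := law d d0; have := nbhs_infty_ge 1; apply: filterS3 lip => n lip n1.
  move=> /(_ _ (mu_powerP n n1))[_ H] x /Ir xr.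
  by apply: (density_near_semicircle lip xr) => [|t t01]; [lra|exact: H].
Qed.
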